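(* Let assumptions (H1)-(H3) listed in the context hold, let $u^*\in\mathcal{U}$ be an optimal control with state process $\{X_k^*\}$, and let $P^*\in\mathcal{P}^*$ satisfy $\inf_{u\in\mathcal{U}}E_{P^*}[\Theta^u]\ge0$. Then the adjoint equation under $P^*$ (given in the context) has a unique solution $\{(P_k,Q_k):k=0,\ldots,N-1\}$ such that, for each $k=N-1,\ldots,0$ and each $\xi\in L_{P^*}^2(\mathcal{F}_k)$, $$E_{P^*}\big[|P_k||\xi|+|Q_k||\xi|\big]<\infty,$$ where $L_{P^*}^2(\mathcal{F}_k)$ is the set of $\mathcal{F}_k$-measurable $\xi$ with $E_{P^*}[|\xi|^2]<\infty$.
   Context: Noise. Let $\Omega$ be a sample space, $N$ a positive integer, $W_k=(W_k^1,\ldots,W_k^d)^T:\Omega\to\mathbb{R}^d$, $k=1,\ldots,N$, given functions, $W=(W_1,\ldots,W_N)$, $\mathcal{F}_k=\sigma\{W_1,\ldots,W_k\}$, $\mathcal{F}_0=\{\emptyset,\Omega\}$. $C_{b,Lip}$ denotes bounded Lipschitz functions and $Lip(\mathcal{F}_k)=\{\phi(W_1,\ldots,W_k):\phi\in C_{b,Lip}(\mathbb{R}^{d\times k})\}$. Let $\{F_\theta:\theta\in\Theta\}$ be a family of probability measures on $\mathbb{R}^d$. Define $\hat{\mathbb{E}}[\varphi(W_k)]=\sup_{\theta\in\Theta}\int\varphi\,dF_\theta$ for $\varphi\in C_{b,Lip}(\mathbb{R}^d)$, and for $\phi\in C_{b,Lip}(\mathbb{R}^{d\times N})$ set $\phi_N=\phi$,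 $\phi_k(x_1,\ldots,x_k)=\hat{\mathbb{E}}[\phi_{k+1}(x_1,\ldots,x_k,W_{k+1})]$ for $k=N-1,\ldots,1$, and $\hat{\mathbb{E}}[\phi(W_1,\ldots,W_N)]=\hat{\mathbb{E}}[\phi_1(W_1)]$. Standing assumptions: (A1) $W(\Omega)=A_1\times\cdots\times A_N$ with $A_k=W_k(\Omega)$ and $F_\theta(\bar A_k)=1$ for all $\theta,k$ ($\bar A_k$ the closure of $A_k$); (A2) $\sup_\theta\int|x|F_\theta(dx)<\infty$; (A3) for each $Q\in\mathcal{A}$ there is a probability measure $P$ on $(\Omega,\mathcal{F}_N)$ with $Q=P\circ W^{-1}$, where $\mathcal{A}$ is the set of probability measures $Q$ on $\mathbb{R}^{d\times N}$ with $E_Q[\phi]\le\hat{\mathbb{E}}[\phi(W)]$ for all $\phi\in C_{b,Lip}(\mathbb{R}^{d\times N})$. Let $\mathcal{P}$ be the set of probability measures $P$ on $(\Omega,\mathcal{F}_N)$ with $E_P[\phi(W)]\le\hat{\mathbb{E}}[\phi(W)]$ for all $\phi\in C_{b,Lip}(\mathbb{R}^{d\times N})$. A set $B\in\mathcal{F}_N$ is polar if $\sup_{P\in\mathcal{P}}P(B)=0$; random variables equal outside a polar set are identified. $\hat{\mathbb{E}}$ is extended by $\hat{\mathbb{E}}[X]=\sup_{P\in\mathcal{P}}E_P[X]$ to all $\mathcal{F}_N$-measurable $X$ with $\sup_{P\in\mathcal{P}}E_P[|X|]<\infty$. $L_c^p(\mathcal{F}_k)$ is the completion of $Lip(\mathcal{F}_k)$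 under $\|X\|_p=(\hat{\mathbb{E}}[|X|^p])^{1/p}$ (a closed subspace of the $\mathcal{F}_k$-measurable $X$ with $\hat{\mathbb{E}}[|X|^p]<\infty$), and $L_c^p(\mathcal{F}_0)=\mathbb{R}$. For vector-valued $Z$, ''$|Z|\in L_c^2(\mathcal{F}_k)$'' means that all components of $Z$ lie in $L_c^2(\mathcal{F}_k)$. Standing assumption: $|W_k|\in L_c^2(\mathcal{F}_k)$ for $k=1,\ldots,N$. Control problem. $U_k\subset\mathbb{R}^m$, $k=0,\ldots,N-1$, are nonempty convex sets; $\mathcal{U}$ is the set of admissible controls $u=\{u_k\}_{k=0}^{N-1}$ with $u_k:\Omega\to U_k$ and $|u_k|\in L_c^2(\mathcal{F}_k)$. The coefficients are $b(k,\cdot),\sigma^l(k,\cdot):\mathbb{R}^n\times U_k\times\Omega\to\mathbb{R}^n$, $f(k,\cdot):\mathbb{R}^n\times U_k\times\Omega\to\mathbb{R}$, $\varphi:\mathbb{R}^n\times\Omega\to\mathbb{R}$ ($l=1,\ldots,d$, $k=0,\ldots,N-1$), with $b,\sigma^l,f$ differentiable in $(x,u)$ and $\varphi$ differentiable in $x$; the argument $\omega$ is suppressed. The state process of $u\in\mathcal{U}$ is the solution of $X_{k+1}=b(k,X_k,u_k)+\sum_{l=1}^d\sigma^l(k,X_k,u_k)W_{k+1}^l$, $X_0=x_0\in\mathbb{R}^n$, $k=0,\ldots,N-1$, and the cost is $J(u)=\hat{\mathbb{E}}[\sum_{k=0}^{N-1}f(k,X_k,u_k)+\varphi(X_N)]$.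 A control $u^*\in\mathcal{U}$ is optimal if it minimizes $J$ over $\mathcal{U}$. (H1) $|b(k,x,u)|,|\sigma^l(k,x,u)|\in L_c^2(\mathcal{F}_k)$, $f(k,x,u)\in L_c^1(\mathcal{F}_k)$, $\varphi(x)\in L_c^1(\mathcal{F}_N)$ for all $x\in\mathbb{R}^n$, $u\in U_k$, $l$, $k$. (H2) There is $L>0$ with $|b_x(k,x,u)|+|b_u(k,x,u)|+|\sigma^l_x(k,x,u)|+|\sigma^l_u(k,x,u)|\le L$ and $|f_x(k,x,u)|+|f_u(k,x,u)|+|\varphi_x(x)|\le L(1+|x|+|u|)$ for all $x\in\mathbb{R}^n$, $u\in U_k$, $l$, $k$. (H3) For each $\alpha>0$ there is a modulus of continuity $\omega_\alpha:[0,\infty)\to[0,\infty)$ (nondecreasing, $\omega_\alpha(r)\to\omega_\alpha(0)=0$ as $r\downarrow0$) such that for all $x,x'\in\mathbb{R}^n$ with $|x|,|x'|\le\alpha$ and $u,u'\in U_k$ with $|u|,|u'|\le\alpha$, $|\phi(k,x,u)-\phi(k,x',u')|+|\varphi_x(x)-\varphi_x(x')|\le\omega_\alpha(|x-x'|+|u-u'|)$, where $\phi(k,\cdot,\cdot)$ is the derivative in $(x,u)$ of any of $b(k,\cdot,\cdot)$, $\sigma^l(k,\cdot,\cdot)$, $f(k,\cdot,\cdot)$. Variational objects. $b_x$ is the Jacobian matrix $(\partial b_i/\partial x_j)$, similarly $b_u,\sigma_x^l,\sigma_u^l$; $f_x,f_u,\varphi_x$ are row vectors. Write $b_x(k)=b_x(k,X_k^*,u_k^*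 )$ and similarly $b_u(k),\sigma_x^l(k),\sigma_u^l(k),f_x(k),f_u(k)$. Given $u\in\mathcal{U}$, $\{\hat X_k\}$ is the solution of $\hat X_0=0$, $$\hat X_{k+1}=b_x(k)\hat X_k+b_u(k)(u_k-u_k^* )+\sum_{l=1}^d\big[\sigma_x^l(k)\hat X_k+\sigma_u^l(k)(u_k-u_k^* )\big]W_{k+1}^l,\quad k=0,\ldots,N-1,$$ and $\Theta^u=\sum_{k=0}^{N-1}[f_x(k)\hat X_k+f_u(k)(u_k-u_k^* )]+\varphi_x(X_N^* )\hat X_N$. Moreover $\mathcal{P}^*=\{P\in\mathcal{P}:E_P[\sum_{k=0}^{N-1}f(k,X_k^*,u_k^* )+\varphi(X_N^* )]=\hat{\mathbb{E}}[\sum_{k=0}^{N-1}f(k,X_k^*,u_k^* )+\varphi(X_N^* )]\}$. Adjoint equation under $P^*$, with unknowns $P_k:\Omega\to\mathbb{R}^n$ and $Q_k=[Q_k^1,\ldots,Q_k^d]:\Omega\to\mathbb{R}^{n\times d}$ (equalities $P^*$-a.s.): $$P_{N-1}=E_{P^*}[\varphi_x^T(X_N^* )|\mathcal{F}_{N-1}],\qquad Q_{N-1}=E_{P^*}[\varphi_x^T(X_N^* )W_N^T|\mathcal{F}_{N-1}],$$ and for $k=N-2,\ldots,0$, $$P_k=E_{P^*}\Big[b_x^T(k+1)P_{k+1}+\sum_{l=1}^d(\sigma_x^l(k+1))^TQ_{k+1}^l+f_x^T(k+1)\Big|\mathcal{F}_k\Big],$$ $$Q_k=E_{P^*}\Big[\Big(b_x^T(k+1)P_{k+1}+\sum_{l=1}^d(\sigma_x^l(k+1))^TQ_{k+1}^l+f_x^T(k+1)\Big)W_{k+1}^T\Big|\mathcal{F}_k\Big].$$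 *)

(* Defs.v *)
From HB Require Import structures.
From mathcomp Require Import all_boot all_order all_algebra.
From mathcomp Require Import all_classical all_reals all_analysis.

Set Implicit Arguments.
Unset Strict Implicit.
Unset Printing Implicit Defensive.

Import Order.TTheory GRing.Theory Num.Theory.
Import numFieldNormedType.Exports.

Local Open Scope classical_set_scope.
Local Open Scope ring_scope.

(* Euclidean norm of a vector, Frobenius norm of a matrix; the library norm on
   'M[R]_(p, q) is the sup norm. *)
Definition enorm (R : realType) (p q : nat) (A : 'M[R]_(p, q)) : R :=
  Num.sqrt (\sum_i \sum_j A i j ^+ 2).

(* R^{p x q} with its Borel sigma-algebra *)
Definition borelM (R : realType) (p q : nat) :=
  g_sigma_algebraType (@open 'M[R]_(p, q)).

Definition CbLip (R : realType) (p q : nat) (phi : 'M[R]_(p, q) -> R) : Prop :=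
  (exists C, forall x, `|phi x| <= C) /\
  (exists C, forall x y, `|phi x - phi y| <= C * enorm (x - y)).

(* J is a Frechet derivative at z of the restriction of g to D. When D is not
   open J need not be unique, so derivatives are handled as data below. *)
Definition jacobian_within (R : realType) (p q : nat) (D : set 'cV[R]_p)
    (g : 'cV[R]_p -> 'cV[R]_q) (z : 'cV[R]_p) (J : 'M[R]_(q, p)) : Prop :=
  forall eps, 0 < eps ->
    \forall y \near within D (nbhs z),
      enorm (g y - g z - J *m (y - z)) <= eps * enorm (y - z).

Definition modulus_of_continuity (R : realType) (rho : R -> R) : Prop :=
  [/\ forall r, 0 <= r -> 0 <= rho r,
      forall r s, 0 <= r -> r <= s -> rho r <= rho s,
      rho 0 = 0 &
      rho r @[r --> 0^'+] --> (0 : R)].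

Section noise.
Context {R : realType} {disp : measure_display} {Omega : measurableType disp}.
Context {Theta : Type} {d : nat}.
Variables (N : nat) (F : Theta -> probability (borelM R d 1) R).
(* W k is used for 1 <= k <= N only *)
Variable W : nat -> Omega -> 'cV[R]_d.

Definition Wmx (k : nat) (w : Omega) : 'M[R]_(d, k) :=
  \matrix_(i, j) W j.+1 w i 0.

Definition Fgen (k : nat) : set (set Omega) :=
  [set A | exists j (B : set 'cV[R]_d),
    [/\ (1 <= j <= k)%N, (<<s @open 'cV[R]_d >>) B & A = W j @^-1` B]].

(* sigma{W_1, ..., W_k}; for k = 0 it is the trivial sigma-algebra *)
Definition Fk (k : nat) : set (set Omega) := <<s Fgen k >>.

Definition Fk_measurable (k : nat) (X : Omega -> R) : Prop :=
  @measurable_fun _ _ (g_sigma_algebraType (Fgen k)) R setT X.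

Definition E1 (phi : 'cV[R]_d -> R) : R :=
  sup (range (fun theta => \int[F theta]_x phi x)).

Definition set_col (x : 'M[R]_(d, N)) (k : nat) (y : 'cV[R]_d) : 'M[R]_(d, N) :=
  \matrix_(i, j) if j == k :> nat then y i 0 else x i j.

(* phi_(N - j), seen as a function on R^{d x N} that does not depend on the
   last j columns (columns are numbered from 0). *)
Fixpoint back_phi (phi : 'M[R]_(d, N) -> R) (j : nat) : 'M[R]_(d, N) -> R :=
  if j is i.+1 then
    fun x => E1 (fun y => back_phi phi i (set_col x (N - i.+1) y))
  else phi.

(* Ehat[phi(W)] for phi in C_{b,Lip}(R^{d x N}); back_phi phi N is constant *)
Definition Elip (phi : 'M[R]_(d, N) -> R) : R := back_phi phi N 0.

(* the set of probability measures on (Omega, F_N) dominated by Ehat *)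
Definition calP : set (probability Omega R) :=
  [set P : probability Omega R | forall phi, CbLip phi ->
    ('E_P[fun w => phi (Wmx N w)] <= (Elip phi)%:E)%E].

(* the set of probability measures on R^{d x N} dominated by Ehat *)
Definition calA : set (probability (borelM R d N) R) :=
  [set Q : probability (borelM R d N) R | forall phi : 'M[R]_(d, N) -> R,
    CbLip phi -> ('E_Q[phi : borelM R d N -> R] <= (Elip phi)%:E)%E].

Definition assumption_A1 : Prop :=
  range (Wmx N) =
    [set x | forall k : 'I_N, range (W k.+1) (col k x)] /\
  forall theta k, (1 <= k <= N)%N -> F theta (closure (range (W k))) = 1%E.

Definition assumption_A2 : Prop :=
  (ereal_sup (range (fun theta => \int[F theta]_x (enorm x)%:E)) < +oo)%E.

Definition assumption_A3 : Prop :=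
  forall Q, calA Q -> exists P : probability Omega R,
    forall B : set (borelM R d N), measurable B -> Q B = P (Wmx N @^-1` B).

Definition Ehat (X : Omega -> R) : \bar R :=
  ereal_sup [set ('E_P[X])%E | P in calP].

Definition polar (B : set Omega) : Prop :=
  measurable B /\ ereal_sup [set P B | P in calP] = 0%E.

Definition qs_eq (X Y : Omega -> R) : Prop :=
  exists2 B, polar B & forall w, ~ B w -> X w = Y w.

Definition normLp (p : nat) (X : Omega -> R) : \bar R :=
  (Ehat (fun w => `|X w| ^+ p)%R `^ (p%:R^-1)%R)%E.

(* The random variables (F_N-measurable functions) whose class modulo polar
   sets lies in the completion of Lip(F_k), realised as the closure of
   Lip(F_k) among the F_k-measurable Y with Ehat[|Y|^p] < +oo. For k = 0
   these are the random variables equal to a constant outside a polar set. *)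
Definition Lc (p k : nat) (X : Omega -> R) : Prop :=
  measurable_fun setT X /\
  exists Y : Omega -> R,
    [/\ qs_eq X Y, Fk_measurable k Y, (Ehat (fun w => `|Y w| ^+ p)%R < +oo)%E &
        forall eps : R, 0 < eps -> exists2 phi : 'M[R]_(d, k) -> R,
          CbLip phi & (normLp p (fun w => Y w - phi (Wmx k w))%R < eps%:E)%E].

Definition Lc_vec (p k q : nat) (X : Omega -> 'cV[R]_q) : Prop :=
  forall i, Lc p k (fun w => X w i 0).

Definition assumption_W : Prop :=
  forall k, (1 <= k <= N)%N -> Lc_vec 2 k (W k).

Definition standing_assumptions : Prop :=
  [/\ assumption_A1, assumption_A2, assumption_A3 & assumption_W].

(* Y is a version of E_P[X | F_k] *)
Definition is_cond_exp (P : probability Omega R) (k : nat)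
    (X Y : Omega -> R) : Prop :=
  [/\ P.-integrable setT (EFin \o X), P.-integrable setT (EFin \o Y),
      Fk_measurable k Y &
      forall B, Fk k B ->
        (\int[P]_(w in B) (Y w)%:E = \int[P]_(w in B) (X w)%:E)%E].

Definition is_cond_exp_mx (P : probability Omega R) (k p q : nat)
    (X Y : Omega -> 'M[R]_(p, q)) : Prop :=
  forall i j, is_cond_exp P k (fun w => X w i j) (fun w => Y w i j).

Definition L2_space (P : probability Omega R) (k : nat) : set (Omega -> R) :=
  [set xi | Fk_measurable k xi /\ ('E_P[fun w => (`|xi w| ^+ 2)%R] < +oo)%E].

End noise.

(* The data of the control problem; families indexed by k are used for k < N
   only, and the coefficients (with their Jacobians) at u \in U k only. *)
Record problem (R : realType) (Omega : Type) (d n m : nat) := Problem {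
  U : nat -> set 'cV[R]_m ;
  x0 : 'cV[R]_n ;
  b : nat -> 'cV[R]_n -> 'cV[R]_m -> Omega -> 'cV[R]_n ;
  sigma : 'I_d -> nat -> 'cV[R]_n -> 'cV[R]_m -> Omega -> 'cV[R]_n ;
  f : nat -> 'cV[R]_n -> 'cV[R]_m -> Omega -> R ;
  varphi : 'cV[R]_n -> Omega -> R ;
  b_x : nat -> 'cV[R]_n -> 'cV[R]_m -> Omega -> 'M[R]_(n, n) ;
  b_u : nat -> 'cV[R]_n -> 'cV[R]_m -> Omega -> 'M[R]_(n, m) ;
  sigma_x : 'I_d -> nat -> 'cV[R]_n -> 'cV[R]_m -> Omega -> 'M[R]_(n, n) ;
  sigma_u : 'I_d -> nat -> 'cV[R]_n -> 'cV[R]_m -> Omega -> 'M[R]_(n, m) ;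
  f_x : nat -> 'cV[R]_n -> 'cV[R]_m -> Omega -> 'rV[R]_n ;
  f_u : nat -> 'cV[R]_n -> 'cV[R]_m -> Omega -> 'rV[R]_m ;
  varphi_x : 'cV[R]_n -> Omega -> 'rV[R]_n }.

Section control.
Context {R : realType} {disp : measure_display} {Omega : measurableType disp}.
Context {Theta : Type} {d n m : nat}.
Variables (N : nat) (F : Theta -> probability (borelM R d 1) R).
Variable W : nat -> Omega -> 'cV[R]_d.
Variable pb : problem R Omega d n m.

Definition convex_controls : Prop :=
  forall k, (k < N)%N -> U pb k !=set0 /\ convex_set (U pb k).

(* g is differentiable in (x, u) on R^n x V, with Jacobian [J_x, J_u] *)
Definition jacobian_xu (q : nat) (V : set 'cV[R]_m)
    (g : 'cV[R]_n -> 'cV[R]_m -> 'cV[R]_q)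
    (J_x : 'cV[R]_n -> 'cV[R]_m -> 'M[R]_(q, n))
    (J_u : 'cV[R]_n -> 'cV[R]_m -> 'M[R]_(q, m)) : Prop :=
  forall x u, V u ->
    jacobian_within [set z : 'cV[R]_(n + m) | V (dsubmx z)]
      (fun z : 'cV[R]_(n + m) => g (usubmx z) (dsubmx z)) (col_mx x u)
      (row_mx (J_x x u) (J_u x u)).

Definition differentiable_coefficients : Prop :=
  (forall k w, (k < N)%N ->
    [/\ jacobian_xu (U pb k) (fun x u => b pb k x u w)
          (fun x u => b_x pb k x u w) (fun x u => b_u pb k x u w),
        forall l, jacobian_xu (U pb k) (fun x u => sigma pb l k x u w)
          (fun x u => sigma_x pb l k x u w) (fun x u => sigma_u pb l k x u w) &
        jacobian_xu (U pb k) (fun x u => (f pb k x u w)%:M)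
          (fun x u => f_x pb k x u w) (fun x u => f_u pb k x u w)]) /\
  (forall x w, jacobian_within setT
     (fun y => (varphi pb y w)%:M : 'cV[R]_1) x (varphi_x pb x w)).

Definition assumption_H1 : Prop :=
  (forall k x u, (k < N)%N -> U pb k u ->
    [/\ Lc_vec N F W 2 k (b pb k x u),
        forall l, Lc_vec N F W 2 k (sigma pb l k x u) &
        Lc N F W 1 k (f pb k x u)]) /\
  (forall x, Lc N F W 1 N (varphi pb x)).

Definition assumption_H2 : Prop :=
  exists2 L : R, 0 < L &
    forall k x u w, (k < N)%N -> U pb k u ->
      (forall l, enorm (b_x pb k x u w) + enorm (b_u pb k x u w) +
         enorm (sigma_x pb l k x u w) + enorm (sigma_u pb l k x u w) <= L) /\
      enorm (f_x pb k x u w) + enorm (f_u pb k x u w) +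
        enorm (varphi_x pb x w) <= L * (1 + enorm x + enorm u).

(* D k x u w is any of the Jacobians in (x, u) of b, sigma^l and f *)
Definition H3_bound (q : nat) (rho : R -> R) (alpha : R)
    (D : nat -> 'cV[R]_n -> 'cV[R]_m -> Omega -> 'M[R]_(q, n + m)) : Prop :=
  forall k x x' u u' w, (k < N)%N -> U pb k u -> U pb k u' ->
    enorm x <= alpha -> enorm x' <= alpha ->
    enorm u <= alpha -> enorm u' <= alpha ->
    enorm (D k x u w - D k x' u' w) +
      enorm (varphi_x pb x w - varphi_x pb x' w)
    <= rho (enorm (x - x') + enorm (u - u')).

Definition assumption_H3 : Prop :=
  forall alpha : R, 0 < alpha ->
    exists2 rho, modulus_of_continuity rho &
      [/\ H3_bound rho alpha
            (fun k x u w => row_mx (b_x pb k x u w) (b_u pb k x u w)),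
          forall l, H3_bound rho alpha
            (fun k x u w => row_mx (sigma_x pb l k x u w)
                                   (sigma_u pb l k x u w)) &
          H3_bound rho alpha
            (fun k x u w => row_mx (f_x pb k x u w) (f_u pb k x u w))].

Definition admissible : set (nat -> Omega -> 'cV[R]_m) :=
  [set u | forall k, (k < N)%N ->
    (forall w, U pb k (u k w)) /\ Lc_vec N F W 2 k (u k)].

Fixpoint state (u : nat -> Omega -> 'cV[R]_m) (k : nat) (w : Omega)
    : 'cV[R]_n :=
  if k is j.+1 then
    b pb j (state u j w) (u j w) w +
    \sum_(l < d) W j.+1 w l 0 *: sigma pb l j (state u j w) (u j w) w
  else x0 pb.

Definition total_cost (u : nat -> Omega -> 'cV[R]_m) (w : Omega) : R :=
  \sum_(k < N) f pb k (state u k w) (u k w) w + varphi pb (state u N w) w.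

Definition cost (u : nat -> Omega -> 'cV[R]_m) : \bar R :=
  Ehat N F W (total_cost u).

Definition optimal (ustar : nat -> Omega -> 'cV[R]_m) : Prop :=
  admissible ustar /\ forall u, admissible u -> (cost ustar <= cost u)%E.

Variable ustar : nat -> Omega -> 'cV[R]_m.

Definition Pstar_set : set (probability Omega R) :=
  [set P | calP N F W P /\ ('E_P[total_cost ustar] = cost ustar)%E].

(* the coefficient g at time k along the optimal state and control *)
Definition at_star (T : Type) (g : nat -> 'cV[R]_n -> 'cV[R]_m -> Omega -> T)
    (k : nat) (w : Omega) : T := g k (state ustar k w) (ustar k w) w.

Fixpoint Xhat (u : nat -> Omega -> 'cV[R]_m) (k : nat) (w : Omega)
    : 'cV[R]_n :=
  if k is j.+1 then
    at_star (b_x pb) j w *m Xhat u j w +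
    at_star (b_u pb) j w *m (u j w - ustar j w) +
    \sum_(l < d) W j.+1 w l 0 *:
      (at_star (sigma_x pb l) j w *m Xhat u j w +
       at_star (sigma_u pb l) j w *m (u j w - ustar j w))
  else 0.

Definition first_variation (u : nat -> Omega -> 'cV[R]_m) (w : Omega) : R :=
  (\sum_(k < N) (at_star (f_x pb) k w *m Xhat u k w +
                 at_star (f_u pb) k w *m (u k w - ustar k w)) +
   varphi_x pb (state ustar N w) w *m Xhat u N w) 0 0.

(* b_x^T(k) P_k + sum_l sigma_x^l(k)^T Q_k^l + f_x^T(k) *)
Definition adjoint_rhs (Pk : nat -> Omega -> 'cV[R]_n)
    (Qk : nat -> Omega -> 'M[R]_(n, d)) (k : nat) (w : Omega) : 'cV[R]_n :=
  (at_star (b_x pb) k w)^T *m Pk k w +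
  \sum_(l < d) (at_star (sigma_x pb l) k w)^T *m col l (Qk k w) +
  (at_star (f_x pb) k w)^T.

Definition adjoint_solution (P : probability Omega R)
    (Pk : nat -> Omega -> 'cV[R]_n) (Qk : nat -> Omega -> 'M[R]_(n, d))
    : Prop :=
  [/\ is_cond_exp_mx W P N.-1
        (fun w => (varphi_x pb (state ustar N w) w)^T) (Pk N.-1),
      is_cond_exp_mx W P N.-1
        (fun w => (varphi_x pb (state ustar N w) w)^T *m (W N w)^T)
        (Qk N.-1) &
      forall k, (k.+1 < N)%N ->
        is_cond_exp_mx W P k (adjoint_rhs Pk Qk k.+1) (Pk k) /\
        is_cond_exp_mx W P k
          (fun w => adjoint_rhs Pk Qk k.+1 w *m (W k.+1 w)^T) (Qk k)].

Definition adjoint_bound (P : probability Omega R)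
    (Pk : nat -> Omega -> 'cV[R]_n) (Qk : nat -> Omega -> 'M[R]_(n, d))
    : Prop :=
  forall k xi, (k < N)%N -> L2_space W P k xi ->
    ('E_P[fun w => (enorm (Pk k w) * `|xi w| + enorm (Qk k w) * `|xi w|)%R]
       < +oo)%E.

End control.

(* Main.v *)
Require Import Defs.
From HB Require Import structures.
From mathcomp Require Import all_boot all_order all_algebra.
From mathcomp Require Import all_classical all_reals all_analysis.
From mathcomp Require Import measurable_realfun ring lra.

(** The adjoint equation is solved backwards by conditional expectations, and
    the whole proof is about square integrability under the given measure P.
    If zeta is square integrable, then so are E[zeta | F_k] and
    E[zeta W_(k+1)^T | F_k]; the next right-hand side is built from these two
    with bounded coefficients and a gradient of linear growth, so it is square
    integrable again and the recursion continues. The required bound is then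
    the Cauchy-Schwarz inequality, and uniqueness is the almost sure uniqueness
    of conditional expectations.

    What has to be proved is that the noise W_(k+1), which need not be
    independent of F_k under P, has a bounded conditional second moment:
    E_P[W_(k+1)^2; A] <= C P(A) for A in F_k. Two facts give this.

    - P is dominated by Ehat, and the backward recursion that defines Ehat
      assigns a nonpositive value to phi(W_1, ..., W_k) (g(W_(k+1)) - c) when
      phi is nonnegative and c bounds all integrals of g with respect to the
      F theta ([one_step_domination]). An approximation of indicators by test
      functions phi ([approximable_le]) carries the resulting inequality to
      F_k, and also to the P-null sets ([past_second_moment]).

    - The integrals of the truncated squares with respect to the F theta are
      bounded uniformly in theta and in the truncation ([F_moment]). Indeed
      the product measure with all marginals F theta is dominated by Ehat
      ([exists_product_measure]), so [assumption_A3] realises it by a dominated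
      measure on Omega, and under these W_(k+1) has bounded second moments
      because it belongs to L_c^2.

    The bounded conditional second moment is used twice. It shows that the
    product of a square integrable variable of the past with the next noise is
    square integrable, whence the state process is square integrable
    ([state_square_integrable]); here the linear growth of the coefficients
    comes from the mean value inequality on the convex set of controls. And it
    gives the conditional Cauchy-Schwarz inequality
    E[X V | F_k]^2 <= c E[X^2 | F_k] with V a component of W_(k+1)
    ([cond_exp_square_integrable]).

    Measurability needs care because U_k is only a convex set, possibly not
    Borel, and the coefficients are F_k-measurable up to polar sets only. The
    first point is met by a Caratheodory argument with a discretisation inside
    the domain ([measurable_fun_caratheodory]), the second by enlarging F_k
    by null sets ([past]). The derivatives in x are limits of difference
    quotients of the coefficients, hence measurable as well. *)

Set Implicit Arguments.
Unset Strict Implicit.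
Unset Printing Implicit Defensive.

Import Order.TTheory GRing.Theory Num.Theory.
Import numFieldNormedType.Exports.

Local Open Scope classical_set_scope.
Local Open Scope ring_scope.

(** * Euclidean norm and Borel sets of matrices *)

Section enorm.
Context {R : realType} {p q : nat}.
Implicit Types A B : 'M[R]_(p, q).

Let enorm_arg_ge0 A : 0 <= \sum_i \sum_j A i j ^+ 2.
Proof. by apply: sumr_ge0 => i _; apply: sumr_ge0 => j _; exact: sqr_ge0. Qed.

Lemma enorm_ge0 A : 0 <= enorm A.
Proof. exact: sqrtr_ge0. Qed.

Lemma sqr_enorm A : enorm A ^+ 2 = \sum_i \sum_j A i j ^+ 2.
Proof. by rewrite sqr_sqrtr. Qed.

Lemma ler_enorm_entry A i j : `|A i j| <= enorm A.
Proof.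
rewrite -ler_sqr ?nnegrE ?enorm_ge0// sqr_enorm real_normK ?num_real//.
rewrite (bigD1 i)//= (bigD1 j)//= -addrA lerDl addr_ge0//.
  by apply: sumr_ge0 => ? _; exact: sqr_ge0.
by apply: sumr_ge0 => ? _; apply: sumr_ge0 => ? _; exact: sqr_ge0.
Qed.

Lemma ler_enorm_sum A : enorm A <= \sum_i \sum_j `|A i j|.
Proof.
have sq_le (I : finType) (x : I -> R) : (forall i, 0 <= x i) ->
    \sum_i x i ^+ 2 <= (\sum_i x i) ^+ 2.
  move=> x0; rewrite expr2 mulr_suml; apply: ler_sum => i _.
  rewrite expr2 ler_wpM2l// (bigD1 i)//= lerDl.
  exact: sumr_ge0.
have s0 i : 0 <= \sum_j `|A i j| by apply: sumr_ge0.
rewrite -ler_sqr ?nnegrE ?enorm_ge0//; last exact: sumr_ge0.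
rewrite sqr_enorm; apply: le_trans (sq_le _ _ s0).
apply: ler_sum => i _; apply: le_trans (sq_le _ _ _) => //.
by apply: ler_sum => j _; rewrite real_normK ?num_real.
Qed.

End enorm.

Lemma ler_enorm (R : realType) (p q p' q' : nat) (A : 'M[R]_(p, q))
    (B : 'M[R]_(p', q')) :
  \sum_i \sum_j A i j ^+ 2 <= \sum_i \sum_j B i j ^+ 2 -> enorm A <= enorm B.
Proof. exact: ler_wsqrtr. Qed.

Section borel_matrices.
Context {R : realType} {p q : nat}.

Let box (c : 'M[rat]_(p, q) * nat) : set 'M[R]_(p, q) :=
  [set x | forall i j, `|x i j - ratr (c.1 i j)| < c.2.+1%:R^-1].

Let open_bigcup_boxes (O : set 'M[R]_(p, q)) : open O ->
  O = \bigcup_(c in [set c | box c `<=` O]) box c.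
Proof.
move=> oO; apply/seteqP; split=> [x Ox|x [c /= cO xc]]; last exact: cO.
have /nbhs_ballP[e /= e0 xeO] := open_nbhs_nbhs (conj oO Ox).
have [k ke] : exists k : nat, k.+1%:R^-1 < e / 2.
  have /ltr_add_invr[k] : 0 < e / 2 by rewrite divr_gt0.
  by rewrite add0r => ?; exists k.
have ratc i j : exists r : rat, `|x i j - ratr r : R| < k.+1%:R^-1.
  have : x i j - k.+1%:R^-1 < x i j + k.+1%:R^-1.
    by rewrite ltrBlDr -addrA ltrDl addr_gt0.
  move=> /rat_in_itvoo[r]; rewrite in_itv/= => /andP[r1 r2]; exists r.
  by rewrite distrC ltr_distl r1 r2.
pose c := \matrix_(i < p, j < q) sval (cid (ratc i j)).
have cE i j : `|x i j - ratr (c i j) : R| < k.+1%:R^-1.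
  by rewrite mxE; case: cid.
exists (c, k) => //= y yc; apply: xeO; split => // i j.
rewrite /ball /= -(subrKA (ratr (c i j))) (le_lt_trans (ler_normD _ _))//.
rewrite [e]splitr ltrD// ?(lt_trans (cE i j))//.
by rewrite distrC (lt_trans (yc i j)).
Qed.

(** The topology of a space of matrices has a countable basis of boxes, so the
    Borel sigma-algebra is generated by the coordinates. *)
Lemma measurable_fun_matrix d (T : measurableType d)
    (X : T -> borelM R p q) :
  (forall i j, measurable_fun setT (fun w => X w i j)) -> measurable_fun setT X.
Proof.
move=> mX; apply: (@measurability _ _ _ (borelM R p q) _ _
  (@open 'M[R]_(p, q)) erefl) => _ [V oV <-].
rewrite setTI.
rewrite (open_bigcup_boxes oV) preimage_bigcup.
rewrite bigcup_mkcond; apply: countable_bigcupT_measurable => // c.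
case: ifP => // _.
have -> : X @^-1` box c =
    \bigcap_(ij in [set: 'I_p * 'I_q]) ((fun w => X w ij.1 ij.2) @^-1`
      (ball (ratr (c.1 ij.1 ij.2) : R) c.2.+1%:R^-1)).
  apply/seteqP; split => w /= Xw.
    by move=> [i j] _ /=; rewrite /ball/= distrC.
  by move=> i j; have := Xw (i, j) I; rewrite /ball/= distrC.
apply: fin_bigcap_measurable => // -[i j] _.
rewrite -[X in measurable X]setTI; apply: mX => //.
by rewrite ball_itv; exact: measurable_itv.
Qed.

Lemma continuous_measurable_borelM (phi : 'M[R]_(p, q) -> R) :
  continuous phi -> measurable_fun setT (phi : borelM R p q -> R).
Proof.
move=> /continuousP cphi; apply: (measurability _ (RGenOpens.measurableE R)).
move=> _ [_ [a [b ->] <-]]; rewrite setTI.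
by apply: sub_gen_smallest; apply: cphi; exact: interval_open.
Qed.

Lemma lipschitz_continuous (phi : 'M[R]_(p, q) -> R) C :
  (forall x y, `|phi x - phi y| <= C * enorm (x - y)) -> continuous phi.
Proof.
move=> phiC x; have xF : Filter (nbhs x) := nbhs_filter x.
apply/cvgrPdist_lt => e e0.
have C0 : 0 < 1 + `|C| by rewrite ltr_wpDr.
pose r := e / ((1 + `|C|) * (p * q).+1%:R).
have r0 : 0 < r by rewrite divr_gt0// mulr_gt0.
apply: (filterS _ (nbhsx_ballx x r r0)) => y xy.
rewrite (le_lt_trans (phiC _ _))//.
have : enorm (x - y) <= (p * q)%:R * r.
  apply: le_trans (ler_enorm_sum _) _.
  have -> : (p * q)%:R * r = \sum_(i < p) \sum_(j < q) r.
    by rewrite !sumr_const !card_ord -mulrnA mulr_natl mulnC.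
  apply: ler_sum => i _; apply: ler_sum => j _; rewrite !mxE.
  by case: xy => _ /(_ i j); rewrite /ball/= => /ltW.
move=> xyr; rewrite (@le_lt_trans _ _ ((1 + `|C|) * ((p * q)%:R * r)))//.
  have [C1|C1] := leP C 0.
    apply: (@le_trans _ _ 0); first by rewrite mulr_le0_ge0// enorm_ge0.
    by rewrite !mulr_ge0// ltW.
  by rewrite ler_pM// ?enorm_ge0// ?(ltW C1)// (le_trans (ler_norm C))// lerDr.
have -> : (1 + `|C|) * ((p * q)%:R * r) = e * ((p * q)%:R / (p * q).+1%:R).
  by rewrite /r; field; rewrite (gt_eqF C0) andbT -natrM nat1r pnatr_eq0.
by rewrite gtr_pMr// ltr_pdivrMr// mul1r ltr_nat.
Qed.

End borel_matrices.

(** * Bounded Lipschitz functions and the sublinear expectation *)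

Lemma bounded_integrable (R : realType) d (T : measurableType d)
    (P : probability T R) (f : T -> R) (C : R) :
  measurable_fun setT f -> (forall x, `|f x| <= C) ->
  P.-integrable setT (EFin \o f).
Proof.
move=> mf fC; apply: (@le_integrable _ _ _ P setT _ _ (EFin \o cst C)) => //.
- exact/measurable_EFinP.
- move=> x _ /=; rewrite lee_fin; apply: le_trans (fC x) _.
  exact: ler_norm.
- exact: finite_measure_integrable_cst.
Qed.

Lemma Rintegral_cst_prob (R : realType) d (T : measurableType d)
    (P : probability T R) (c : R) : \int[P]_x (cst c x) = c.
Proof.
rewrite /cst Rintegral_cst// -[RHS]mulr1; congr (_ * _).
by rewrite -[RHS]/(fine 1%E); congr fine; exact: probability_setT.
Qed.

Section bounded_lipschitz.
Context {R : realType} {p q : nat}.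
Implicit Types phi psi : 'M[R]_(p, q) -> R.

Lemma CbLip_measurable phi : CbLip phi ->
  measurable_fun setT (phi : borelM R p q -> R).
Proof.
move=> [_ [C phiC]]; apply: continuous_measurable_borelM.
exact: lipschitz_continuous phiC.
Qed.

Lemma CbLip_integrable (mu : probability (borelM R p q) R) phi : CbLip phi ->
  mu.-integrable setT (EFin \o phi).
Proof.
move=> cphi; have [[C phiC] _] := cphi.
apply: (@bounded_integrable _ _ (borelM R p q) mu phi C) => //.
exact: CbLip_measurable.
Qed.

Lemma CbLip_cst c : CbLip (fun _ : 'M[R]_(p, q) => c).
Proof.
split; first by exists `|c|.
by exists 0 => x y; rewrite subrr normr0 mul0r.
Qed.

Lemma CbLipB phi psi : CbLip phi -> CbLip psi -> CbLip (fun x => phi x - psi x).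
Proof.
move=> [[C phiC] [D phiD]] [[C' psiC] [D' psiD]]; split.
  exists (C + C') => x; apply: le_trans (ler_normB _ _) _.
  exact: lerD.
exists (D + D') => x y.
have -> : phi x - psi x - (phi y - psi y) =
    phi x - phi y - (psi x - psi y) by ring.
by rewrite (le_trans (ler_normB _ _))// mulrDl lerD.
Qed.

Lemma CbLipM phi psi : CbLip phi -> CbLip psi -> CbLip (fun x => phi x * psi x).
Proof.
move=> [[C phiC] [D phiD]] [[C' psiC] [D' psiD]]; split.
  by exists (C * C') => x; rewrite normrM ler_pM.
exists (C * D' + C' * D) => x y.
have -> : phi x * psi x - phi y * psi y =
    phi x * (psi x - psi y) + psi y * (phi x - phi y) by ring.
rewrite (le_trans (ler_normD _ _))// mulrDl -!mulrA !normrM.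
by rewrite lerD// ler_pM.
Qed.

Lemma CbLip_entry (h : R -> R) C D i j : (forall r, `|h r| <= C) ->
  (forall r s, `|h r - h s| <= D * `|r - s|) ->
  CbLip (fun x : 'M[R]_(p, q) => h (x i j)).
Proof.
move=> hC hD; split; first by exists C.
exists D => x y; apply: le_trans (hD _ _) _; rewrite ler_wpM2l//.
  have := hD 1 0; rewrite subr0 normr1 mulr1; exact: le_trans.
by rewrite (le_trans _ (ler_enorm_entry _ i j))// !mxE.
Qed.

End bounded_lipschitz.

Lemma entry_measurable (R : realType) (p q : nat) i j :
  measurable_fun setT (fun x : borelM R p q => x i j).
Proof.
apply: continuous_measurable_borelM.
apply: (@lipschitz_continuous _ _ _ _ 1) => x y.
by rewrite mul1r (le_trans _ (ler_enorm_entry _ i j))// !mxE.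
Qed.

Definition depends_on (R : realType) (d N k : nat) (phi : 'M[R]_(d, N) -> R) :=
  forall x x' : 'M[R]_(d, N),
    (forall i (l : 'I_N), (l < k)%N -> x i l = x' i l) -> phi x = phi x'.

Section set_col.
Context {R : realType} {d N : nat}.
Implicit Types (x : 'M[R]_(d, N)) (y : 'cV[R]_d).

Lemma set_colE x k y i j :
  set_col x k y i j = if j == k :> nat then y i 0 else x i j.
Proof. by rewrite mxE. Qed.

Lemma set_col_lip_mx x x' k y :
  enorm (set_col x k y - set_col x' k y) <= enorm (x - x').
Proof.
apply: ler_enorm; apply: ler_sum => i _; apply: ler_sum => j _.
rewrite !mxE; case: ifP => _ //.
by rewrite subrr expr0n/= sqr_ge0.
Qed.

Lemma set_col_lip_col x k y y' :
  enorm (set_col x k y - set_col x k y') <= enorm (y - y').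
Proof.
apply: ler_enorm; apply: ler_sum => i _; rewrite big_ord1.
have [kN|Nk] := ltnP k N.
  rewrite (bigD1 (Ordinal kN))//= big1 ?addr0 ?mxE ?eqxx// => j jk.
  rewrite !mxE; case: ifPn => [/eqP jk'|_]; last by rewrite subrr expr0n.
  by case/eqP: jk; exact: val_inj.
rewrite big1 ?sqr_ge0// => j _; rewrite !mxE ltn_eqF ?subrr ?expr0n//.
exact: leq_trans (ltn_ord j) Nk.
Qed.

Lemma CbLip_set_col phi x k : CbLip phi -> CbLip (fun y => phi (set_col x k y)).
Proof.
move=> [[C phiC] [D phiD]]; split; first by exists C.
exists `|D| => y y'; apply: le_trans (phiD _ _) _.
rewrite (le_trans (ler_wpM2r (enorm_ge0 _) (ler_norm D)))// ler_wpM2l//.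
exact: set_col_lip_col.
Qed.

End set_col.

Section sublinear.
Context {R : realType} {Theta : Type} {d : nat}.
Hypothesis hTheta : inhabited Theta.
Variable F : Theta -> probability (borelM R d 1) R.

Lemma range_F_nonempty (psi : 'cV[R]_d -> R) :
  range (fun theta => \int[F theta]_x psi x) !=set0.
Proof. by case: hTheta => th; exists (\int[F th]_x psi x), th. Qed.

Lemma Rintegral_bound (mu : probability (borelM R d 1) R)
    (psi : 'cV[R]_d -> R) c :
  CbLip psi -> (forall y, psi y <= c) -> \int[mu]_x psi x <= c.
Proof.
move=> cpsi psic; rewrite (@le_trans _ _ (\int[mu]_x (cst c x)))//.
  apply: le_Rintegral => //; first exact: CbLip_integrable.
  exact: finite_measure_integrable_cst.
by rewrite Rintegral_cst_prob.
Qed.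

Lemma le_E1 (psi : 'cV[R]_d -> R) theta :
  CbLip psi -> \int[F theta]_x psi x <= E1 F psi.
Proof.
move=> cpsi; apply: ub_le_sup; last by exists theta.
have [[C psiC] _] := cpsi; exists C => _ [th _ <-].
by apply: Rintegral_bound => // y; rewrite (le_trans (ler_norm _)).
Qed.

Lemma E1_le (psi : 'cV[R]_d -> R) c :
  (forall theta, \int[F theta]_x psi x <= c) -> E1 F psi <= c.
Proof.
by move=> psic; apply: ge_sup; [exact: range_F_nonempty|move=> _ [th _ <-]].
Qed.

Lemma E1_le_cst (psi : 'cV[R]_d -> R) c :
  CbLip psi -> (forall y, psi y <= c) -> E1 F psi <= c.
Proof. by move=> cpsi psic; apply: E1_le => th; exact: Rintegral_bound. Qed.

Lemma E1_ge_cst (psi : 'cV[R]_d -> R) c :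
  CbLip psi -> (forall y, c <= psi y) -> c <= E1 F psi.
Proof.
move=> cpsi psic; case: hTheta => th; apply: le_trans (le_E1 th cpsi).
have -> : c = \int[F th]_x (cst c x).
  by rewrite Rintegral_cst_prob.
apply: le_Rintegral => //; first exact: finite_measure_integrable_cst.
exact: CbLip_integrable.
Qed.

(** A supremum of integrals is 1-Lipschitz for the uniform distance; this is why
    the backward recursion stays within bounded Lipschitz functions. *)
Lemma E1_dist (psi psi' : 'cV[R]_d -> R) c : CbLip psi -> CbLip psi' ->
  (forall y, `|psi y - psi' y| <= c) -> `|E1 F psi - E1 F psi'| <= c.
Proof.
suff H (f g : 'cV[R]_d -> R) : CbLip f -> CbLip g ->
    (forall y, `|f y - g y| <= c) -> E1 F f - E1 F g <= c.
  move=> cp cp' pc; rewrite ler_norml H// andbT lerNl opprB H// => y.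
  by rewrite distrC.
move=> cf cg fgc; rewrite lerBlDr; apply: E1_le => th.
rewrite (le_trans _ (lerD (lexx c) (le_E1 th cg)))// -lerBlDr.
rewrite -RintegralB//; [|exact: CbLip_integrable..].
apply: Rintegral_bound; first exact: CbLipB.
by move=> y; rewrite (le_trans (ler_norm _)).
Qed.

Variable N : nat.
Implicit Types phi : 'M[R]_(d, N) -> R.

Lemma CbLip_E1_set_col phi k : CbLip phi ->
  CbLip (fun x => E1 F (fun y => phi (set_col x k y))).
Proof.
move=> cphi; have [[C bC] [D bD]] := cphi; split.
  exists C => x; rewrite ler_norml E1_ge_cst/= ?E1_le_cst//.
  - exact: CbLip_set_col.
  - by move=> y; rewrite (le_trans (ler_norm _)).
  - exact: CbLip_set_col.
  - by move=> y; have := bC (set_col x k y); rewrite ler_norml => /andP[].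
exists `|D| => x x'; apply: E1_dist; [exact: CbLip_set_col..|].
move=> y; apply: le_trans (bD _ _) _.
rewrite (le_trans (ler_wpM2r (enorm_ge0 _) (ler_norm D)))// ler_wpM2l//.
exact: set_col_lip_mx.
Qed.

Lemma CbLip_back_phi phi j : CbLip phi -> CbLip (back_phi F phi j).
Proof. by move=> cphi; elim: j => //= j; exact: CbLip_E1_set_col. Qed.

(** Each of the last j backward steps takes the expectation of phi over a column
    on which it does not depend, that is, of a constant. *)
Lemma back_phi_le phi k j : CbLip phi -> depends_on k phi ->
  (k + j <= N)%N -> forall x, back_phi F phi j x <= phi x.
Proof.
move=> cphi phik; elim: j => [_ x|j IH kjN x]/=; first exact: lexx.
apply: E1_le_cst; first exact/CbLip_set_col/CbLip_back_phi.
move=> y; apply: (le_trans (IH _ _)).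
  by rewrite (leq_trans _ kjN)// leq_add2l.
rewrite (phik _ x)// => i l lk; rewrite set_colE ltn_eqF//.
apply: (leq_trans lk); rewrite leq_subRL 1?addnC//.
by rewrite (leq_trans _ kjN)// leq_addl.
Qed.

End sublinear.

(** A single integral is the sublinear expectation of a one-element family. *)
Lemma CbLip_integral_set_col (R : realType) (d N : nat)
    (mu : probability (borelM R d 1) R) (phi : 'M[R]_(d, N) -> R) k :
  CbLip phi -> CbLip (fun x => \int[mu]_y phi (set_col x k y)).
Proof.
move=> /(CbLip_E1_set_col (inhabits tt) (fun=> mu) k).
congr (CbLip _); apply/funext => x; rewrite /E1.
rewrite (_ : range _ = [set \int[mu]_y phi (set_col x k y)]) ?sup1//.
by apply/seteqP; split => [_ [_ _ <-]//|_ ->]; exists tt.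
Qed.

(** * Product measures of the marginals *)

Lemma EFin_Rintegral (R : realType) d (T : measurableType d)
    (mu : {measure set T -> \bar R}) (f : T -> R) :
  mu.-integrable setT (EFin \o f) ->
  (\int[mu]_x (f x)%:E)%E = (\int[mu]_x f x)%:E.
Proof. by move=> intf; rewrite /Rintegral fineK// integrable_fin_num. Qed.

Lemma CbLip_col (R : realType) (d N : nat) (g : 'cV[R]_d -> R) (k : 'I_N) :
  CbLip g -> CbLip (fun x : 'M[R]_(d, N) => g (col k x)).
Proof.
move=> [[C gC] [D gD]]; split; first by exists C.
exists `|D| => x y; apply: le_trans (gD _ _) _.
rewrite (le_trans (ler_wpM2r (enorm_ge0 _) (ler_norm D)))// ler_wpM2l//.
apply: ler_enorm; apply: ler_sum => i _; rewrite big_ord1.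
rewrite (bigD1 k)//= !mxE lerDl.
by apply: sumr_ge0 => j _; exact: sqr_ge0.
Qed.

Section noise.
Context {R : realType} {Theta : Type} {d N : nat}.
Hypothesis hTheta : inhabited Theta.
Variable F : Theta -> probability (borelM R d 1) R.

Lemma col_set_col (k : 'I_N) (x : 'M[R]_(d, N)) (y : 'cV[R]_d) :
  col k (set_col x k y) = y.
Proof. by apply/matrixP => i j; rewrite !mxE eqxx ord1. Qed.

Lemma col_set_col_neq (k : 'I_N) (l : nat) (x : 'M[R]_(d, N)) (y : 'cV[R]_d) :
  k != l :> nat -> col k (set_col x l y) = col k x.
Proof. by move=> kl; apply/matrixP => i j; rewrite !mxE (negbTE kl). Qed.

Let back_phi_step (phi : 'M[R]_(d, N) -> R) (k : 'I_N) x :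
  back_phi F phi (N - k) x =
  E1 F (fun y => back_phi F phi (N - k.+1) (set_col x k y)).
Proof.
have Nk : (N - k = (N - k.+1).+1)%N by rewrite -subSS subSn.
by rewrite Nk/= -Nk subKn// ltnW.
Qed.

(** The product measures built from the F theta are dominated by Ehat: each
    backward step of Ehat takes a supremum over the law of one column. *)
Lemma exists_product_measure theta k : (k <= N)%N ->
  exists Q : probability (borelM R d N) R,
    (forall phi, CbLip phi -> \int[Q]_x back_phi F phi (N - k) x <= Elip F phi)
    /\ (forall (j : 'I_N) h, (j < k)%N -> CbLip h ->
         \int[Q]_x h (col j x) = \int[F theta]_y h y).
Proof.
elim: k => [_|k IH kN].
  (* Elip evaluates the fully averaged function, which is constant, at 0. *)
  exists (\d_(0 : borelM R d N)); split => // phi cphi.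
  rewrite subn0 /Elip /Rintegral integral_dirac//.
    by rewrite diracT mul1e.
  apply/measurable_EFinP; apply: CbLip_measurable.
  exact: CbLip_back_phi.
have [Q [Qle Qcol]] := IH (ltnW kN).
(* Column k of Q is resampled independently from F theta. *)
pose X (xy : borelM R d N * borelM R d 1) : borelM R d N :=
  set_col xy.1 k xy.2.
have mX : measurable_fun setT X.
  apply: measurable_fun_matrix => i j.
  have [jk|jk] := eqVneq (j : nat) k.
    rewrite (_ : (fun w => X w i j) =
      (fun y : borelM R d 1 => y i 0) \o snd); last first.
      by apply/funext => w; rewrite /X set_colE jk eqxx.
    exact: measurableT_comp (entry_measurable _ _) measurable_snd.
  rewrite (_ : (fun w => X w i j) =
    (fun x : borelM R d N => x i j) \o fst); last first.
    by apply/funext => w; rewrite /X set_colE (negbTE jk).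
  exact: measurableT_comp (entry_measurable _ _) measurable_fst.
pose Q' := distribution (Q \x F theta)%E (mfun_Sub (mem_set mX)).
have Q'E phi : CbLip phi ->
    \int[Q']_x phi x = \int[Q]_x \int[F theta]_y phi (set_col x k y).
  move=> cphi; have [[C phiC] _] := cphi.
  have mphi := CbLip_measurable cphi.
  have intX : (Q \x F theta)%E.-integrable setT (EFin \o (phi \o X)).
    apply: (@bounded_integrable _ _ _ _ _ C) => [|x]; last exact: phiC.
    exact: measurableT_comp mphi mX.
  rewrite /Rintegral integral_distribution//; last exact/measurable_EFinP.
  rewrite -integral12_prod_meas1//; congr fine.
  apply: eq_integral => x _; rewrite /fubini_F/=.
  rewrite -EFin_Rintegral//.
  by apply: CbLip_integrable; exact: CbLip_set_col.
exists Q'; split.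
  move=> phi cphi; apply: le_trans (Qle _ cphi).
  rewrite Q'E; last exact: CbLip_back_phi.
  apply: le_Rintegral => //.
  - apply: CbLip_integrable; apply: CbLip_integral_set_col.
    exact: CbLip_back_phi.
  - by apply: CbLip_integrable; exact: CbLip_back_phi.
  move=> x _; rewrite (back_phi_step phi (Ordinal kN)).
  by apply: le_E1; apply: CbLip_set_col; exact: CbLip_back_phi.
move=> j h; rewrite ltnS leq_eqVlt => /orP[/eqP jk ch|jk ch].
  rewrite Q'E; last exact: CbLip_col.
  under eq_Rintegral do under eq_Rintegral do rewrite -jk col_set_col.
  by rewrite Rintegral_cst_prob.
rewrite Q'E; last exact: CbLip_col.
under eq_Rintegral do under eq_Rintegral do rewrite col_set_col_neq ?ltn_eqF//.
under eq_Rintegral do rewrite Rintegral_cst_prob.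
exact: Qcol.
Qed.

End noise.

(** * Measures dominated by the sublinear expectation *)

Section truncated_square.
Context {R : realType}.
Implicit Types M r s : R.

(** r ^+ 2 capped at M ^+ 2, in a form whose Lipschitz constant is visible. *)
Definition sqtrunc M r : R := (Num.min `|r| M) ^+ 2.

Lemma sqtrunc_ge0 M r : 0 <= sqtrunc M r.
Proof. exact: sqr_ge0. Qed.

Lemma sqtrunc_le_sqr M r : 0 <= M -> sqtrunc M r <= r ^+ 2.
Proof.
move=> M0; rewrite -(real_normK (num_real r)) ler_sqr ?nnegrE//.
  by rewrite ge_min lexx.
by rewrite le_min M0 normr_ge0.
Qed.

Lemma sqtrunc_bound M r : 0 <= M -> `|sqtrunc M r| <= M ^+ 2.
Proof.
move=> M0; rewrite ger0_norm ?sqtrunc_ge0// ler_sqr ?nnegrE//.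
  by rewrite ge_min lexx orbT.
by rewrite le_min M0 normr_ge0.
Qed.

Lemma sqtrunc_lipschitz M r s : 0 <= M ->
  `|sqtrunc M r - sqtrunc M s| <= 2 * M * `|r - s|.
Proof.
move=> M0; rewrite /sqtrunc subr_sqr normrM mulrC.
have rs0 : 0 <= Num.min `|r| M + Num.min `|s| M.
  by rewrite addr_ge0// le_min normr_ge0.
rewrite ler_pM//.
  by rewrite ger0_norm// mulr_natl mulr2n lerD// ge_min lexx orbT.
apply: le_trans (ler_dist_dist r s).
have := ler_norm (`|r| - `|s|); have := ler_norm (`|s| - `|r|).
rewrite (distrC `|s|) => sr rs; have rs_ge0 := normr_ge0 (`|r| - `|s|).
by rewrite !minElt; case: ltP => a; case: ltP => b //; rewrite ler_norml;
  apply/andP; split; lra.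
Qed.

Lemma sqtrunc_nd r : nondecreasing_seq (fun n => sqtrunc n%:R r).
Proof.
move=> n m nm; have nmR : n%:R <= m%:R :> R by rewrite ler_nat.
have min0 k : 0 <= Num.min `|r| (k%:R) by rewrite le_min normr_ge0 ler0n.
rewrite /sqtrunc ler_sqr ?nnegrE// le_min !ge_min lexx/= nmR orbT.
by [].
Qed.

Lemma cvg_sqtrunc r : sqtrunc n%:R r @[n --> \oo] --> r ^+ 2.
Proof.
apply: cvg_near_cst; near=> n.
rewrite /sqtrunc min_l ?real_normK ?num_real//.
by near: n; exact: nbhs_infty_ger.
Unshelve. all: by end_near. Qed.

End truncated_square.

Lemma Fk_measurable_measurable (R : realType) disp (Omega : measurableType disp)
    (d : nat) (W : nat -> Omega -> 'cV[R]_d) k (Y : Omega -> R) :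
  Fk W k `<=` measurable -> Fk_measurable W k Y -> measurable_fun setT Y.
Proof. by move=> Fk_sub mY _ B mB; apply: Fk_sub; exact: mY. Qed.

Section dominated.
Context {R : realType} {disp : measure_display} {Omega : measurableType disp}.
Context {Theta : Type} {d N : nat}.
Hypothesis hTheta : inhabited Theta.
Variable F : Theta -> probability (borelM R d 1) R.
Variable W : nat -> Omega -> 'cV[R]_d.

Hypothesis hFN : @measurable _ Omega = Fk W N.

Lemma sub_Fk k l : (k <= l)%N -> Fk W k `<=` Fk W l.
Proof.
move=> kl; apply: sub_sigma_algebra2 => _ [j [B [/andP[j1 jk] mB ->]]].
by exists j, B; rewrite j1 (leq_trans jk kl).
Qed.

Lemma Fk_sub_measurable k : (k <= N)%N -> Fk W k `<=` measurable.
Proof. by move=> kN; rewrite hFN; exact: sub_Fk. Qed.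

Lemma polar_null (P : probability Omega R) B :
  calP N F W P -> polar N F W B -> P B = 0%E.
Proof.
move=> PP [mB supB]; apply/eqP; rewrite eq_le measure_ge0 andbT -supB.
by apply: ereal_sup_ubound; exists P.
Qed.

Lemma qs_eq_ae (P : probability Omega R) X Y :
  calP N F W P -> qs_eq N F W X Y -> {ae P, forall w, X w = Y w}.
Proof.
move=> PP [B pB XY]; exists B; split; first exact: pB.1.
  exact: polar_null PP pB.
by move=> w /=; apply: contra_notP => /XY.
Qed.

(** The constant does not depend on P: Ehat of a square is a supremum over all
    dominated measures, and it is finite on L_c^2. *)
Lemma Lc2_moment k X : (k <= N)%N -> Lc N F W 2 k X ->
  exists C : R, forall P, calP N F W P -> (\int[P]_w (X w ^+ 2)%:E <= C%:E)%E.
Proof.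
move=> kN [mX [Y [XY mY Ylty _]]].
have [C YC] : exists C : R, (Ehat N F W (fun w => (`|Y w| ^+ 2)%R) <= C%:E)%E.
  move: Ylty; case: (Ehat N F W _) => [r _|//|_]; first by exists r.
  by exists 0; rewrite leNye.
exists C => P PP; apply: le_trans YC.
apply: ereal_sup_ubound; exists P => //; rewrite unlock.
have mY' := Fk_measurable_measurable (Fk_sub_measurable kN) mY.
apply: ae_eq_integral => //.
- apply/measurable_EFinP; apply: measurable_funX.
  exact: measurableT_comp.
- by apply/measurable_EFinP; exact: measurable_funX.
- have := qs_eq_ae PP XY; apply: filterS => w -> _ /=.
  by rewrite real_normK// num_real.
Qed.

Hypothesis W_Lc : assumption_W N F W.

Lemma W_measurable j i : (j < N)%N ->
  measurable_fun setT (fun w => W j.+1 w i 0).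
Proof. by move=> jN; have [] := W_Lc (k := j.+1) jN i. Qed.

Lemma Wmx_measurable :
  measurable_fun setT (Wmx W N : Omega -> borelM R d N).
Proof.
apply: measurable_fun_matrix => i j.
rewrite (_ : (fun w => _) = fun w => W j.+1 w i 0); first exact: W_measurable.
by apply/funext => w; rewrite mxE.
Qed.

Lemma CbLip_Wmx_integrable (P : probability Omega R) (phi : 'M[R]_(d, N) -> R) :
  CbLip phi -> P.-integrable setT (EFin \o (fun w => phi (Wmx W N w))).
Proof.
move=> cphi; have [[C phiC] _] := cphi.
apply: (@bounded_integrable _ _ _ _ _ C) => //.
exact: measurableT_comp (CbLip_measurable cphi) Wmx_measurable.
Qed.

Lemma calP_Rintegral (P : probability Omega R) (phi : 'M[R]_(d, N) -> R) :
  calP N F W P -> CbLip phi -> \int[P]_w phi (Wmx W N w) <= Elip F phi.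
Proof.
move=> PP cphi; rewrite -lee_fin -EFin_Rintegral.
  by have := PP _ cphi; rewrite unlock.
exact: CbLip_Wmx_integrable.
Qed.

(** The supremum Ehat over dominated measures is turned into information on the
    F theta: the product measure is the law of the noises under some dominated
    measure, so a bound on the second moment of W_(k+1) that holds for all these
    measures holds for F theta. *)
Lemma F_moment (k : 'I_N) (i : 'I_d) : assumption_A3 N F W ->
  exists C : R, forall theta M, 0 <= M ->
    \int[F theta]_y sqtrunc M (y i 0) <= C.
Proof.
move=> A3.
have [C WC] := Lc2_moment (ltn_ord k) (W_Lc (k := k.+1) (ltn_ord k) i).
exists C => theta M M0.
have [Q [Qle Qcol]] := exists_product_measure hTheta F theta (leqnn N).
have ch p q i' j' : CbLip (fun x : 'M[R]_(p, q) => sqtrunc M (x i' j')).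
  apply: (CbLip_entry (C := M ^+ 2) (D := 2 * M)) => [r|r s].
    exact: sqtrunc_bound.
  exact: sqtrunc_lipschitz.
have QE phi : CbLip phi -> (\int[Q]_x (phi x)%:E)%E = (\int[Q]_x phi x)%:E.
  by move=> cphi; rewrite EFin_Rintegral//; exact: CbLip_integrable.
have QA : calA F Q.
  move=> phi cphi; rewrite unlock QE// lee_fin.
  by have := Qle _ cphi; rewrite subnn.
have [P QP] := A3 _ QA.
have PE phi : CbLip phi ->
    (\int[P]_w (phi (Wmx W N w))%:E)%E = (\int[Q]_x (phi x)%:E)%E.
  move=> cphi; rewrite (@eq_measure_integral _ _ _ _
      (distribution P (mfun_Sub (mem_set Wmx_measurable)))); last first.
    by move=> B mB _; exact: QP.
  rewrite integral_distribution//.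
    by apply/measurable_EFinP; exact: CbLip_measurable.
  exact: CbLip_Wmx_integrable.
have PP : calP N F W P.
  by move=> phi cphi; rewrite unlock PE//; have := QA _ cphi; rewrite unlock.
have := Qcol k (fun y => sqtrunc M (y i 0)) (ltn_ord k) (ch _ _ _ _).
move=> <-; rewrite -lee_fin -QE; last exact: CbLip_col (ch _ _ _ _).
rewrite -PE; last exact: CbLip_col (ch _ _ _ _).
apply: le_trans (WC _ PP); apply: ge0_le_integral => //.
- by move=> w _; rewrite lee_fin sqtrunc_ge0.
- apply/measurable_EFinP.
  have mh := CbLip_measurable (CbLip_col k (ch d _ i 0)).
  exact: measurableT_comp mh Wmx_measurable.
- apply/measurable_EFinP; apply: measurable_funX.
  exact: W_measurable.
- move=> w _; rewrite lee_fin !mxE; exact: sqtrunc_le_sqr.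
Qed.

(** Given the first k noises, the law of the next one is dominated by E1. In the
    backward recursion for phi (g - c), with g evaluated at the next column, the
    columns after that one leave the function unchanged, and the expectation
    over it is phi times a supremum of integrals of g - c, which is nonpositive;
    so Ehat of this function is nonpositive. *)
Lemma one_step_domination (P : probability Omega R) (k : 'I_N)
    (phi : 'M[R]_(d, N) -> R) (g : 'cV[R]_d -> R) (c : R) :
    calP N F W P -> CbLip phi -> CbLip g -> (forall x, 0 <= phi x) ->
    depends_on k phi -> (forall theta, \int[F theta]_y g y <= c) ->
  \int[P]_w (phi (Wmx W N w) * g (W k.+1 w)) <= c * \int[P]_w phi (Wmx W N w).
Proof.
move=> PP cphi cg phi0 phik gc.
pose Phi x := phi x * (g (col k x) - c).
have cgc : CbLip (fun y => g y - c) by apply: CbLipB => //; exact: CbLip_cst.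
have cPhi : CbLip Phi by apply: CbLipM => //; exact: CbLip_col cgc.
have step x : back_phi F Phi (N - k) x <= 0.
  have Nk : (N - k = (N - k.+1).+1)%N by rewrite -subSS subSn.
  rewrite Nk/= -Nk subKn 1?ltnW//.
  apply: E1_le => // theta.
  apply: (@le_trans _ _ (\int[F theta]_y (phi x * (g y - c)))).
    apply: le_Rintegral => //.
    + by apply: CbLip_integrable; apply: CbLip_set_col; exact: CbLip_back_phi.
    + by apply: CbLip_integrable; apply: CbLipM => //; exact: CbLip_cst.
    move=> y _; apply: le_trans (back_phi_le hTheta F (k := k.+1) cPhi _ _ _) _.
    + move=> z z' zz'; rewrite /Phi (phik z z') => [|i l lk]; last first.
        by apply: zz'; exact: ltnW.
      by congr (_ * (g _ - _)); apply/matrixP => i j; rewrite !mxE; exact: zz'.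
    + by rewrite subnKC.
    rewrite /Phi col_set_col (phik _ x)// => i l lk.
    by rewrite set_colE ltn_eqF.
  rewrite RintegralZl//; last exact: CbLip_integrable.
  rewrite RintegralB//; last 2 first.
  - exact: CbLip_integrable.
  - exact: CbLip_integrable (CbLip_cst _).
  by rewrite Rintegral_cst_prob mulr_ge0_le0// subr_le0.
have Elip0 : Elip F Phi <= 0.
  have H j x : back_phi F Phi (N - k + j) x <= 0.
    elim: j x => [|j IH] x; first by rewrite addn0.
    rewrite addnS/=; apply: E1_le_cst => //.
    by apply: CbLip_set_col; exact: CbLip_back_phi.
  by have := H k 0; rewrite subnK// ltnW.
have := le_trans (calP_Rintegral PP cPhi) Elip0.
rewrite /Phi.
under eq_Rintegral do rewrite mulrBr.
have int1 := CbLip_Wmx_integrable P (CbLipM cphi (CbLip_col k cg)).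
have int2 := CbLip_Wmx_integrable P (CbLipM cphi (CbLip_cst c)).
rewrite RintegralB// RintegralZr//; last exact: CbLip_Wmx_integrable.
rewrite subr_le0 mulrC.
congr (_ <= _); apply: eq_Rintegral => w _; congr (_ * g _).
by apply/matrixP => i j; rewrite !mxE ord1.
Qed.

End dominated.

(** * Sets approximable by test functions *)

Section integrable_EFin.
Context {R : realType} {disp : measure_display} {T : measurableType disp}.
Variable mu : {measure set T -> \bar R}.
Implicit Types f g : T -> R.

Lemma integrableD_EFin f g :
  mu.-integrable setT (EFin \o f) -> mu.-integrable setT (EFin \o g) ->
  mu.-integrable setT (EFin \o (fun w => f w + g w)).
Proof. by move=> intf intg; exact: (integrableD measurableT intf intg). Qed.

Lemma integrableZ_EFin c f : mu.-integrable setT (EFin \o f) ->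
  mu.-integrable setT (EFin \o (fun w => c * f w)).
Proof. by move=> intf; exact: (integrableZl measurableT c intf). Qed.

End integrable_EFin.

Section approximable.
Context {R : realType} {disp : measure_display} {T : measurableType disp}.
Variable P : probability T R.
Variable H : set (T -> R).
Hypothesis H_meas : forall f, H f -> measurable_fun setT f.
Hypothesis H01 : forall f, H f -> forall w, 0 <= f w <= 1.
Hypothesis H_cst0 : H (cst 0).
Hypothesis H_compl : forall f, H f -> H (fun w => 1 - f w).
Hypothesis H_mul : forall f g, H f -> H g -> H (fun w => f w * g w).

(** Closure in L^1(P) of H, restricted to indicators. Since H is closed under
    complement to 1 and product, these sets form a sigma-algebra. *)
Definition approximable : set (set T) :=
  [set A | measurable A /\ forall e : R, 0 < e ->
    exists2 f, H f & \int[P]_w `|\1_A w - f w| < e].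

Let indic01 (A : set T) w : 0 <= (\1_A w : R) <= 1.
Proof. by rewrite indicE; case: (w \in A); rewrite ?lexx ler01. Qed.

Let dist_integrable A f : measurable A -> H f ->
  P.-integrable setT (EFin \o (fun w => `|\1_A w - f w|)).
Proof.
move=> mA Hf; apply: (@bounded_integrable _ _ _ _ _ 1) => [|w].
  apply: measurableT_comp => //; apply: measurable_funB => //.
  exact: H_meas.
rewrite normr_id ler_norml; have := H01 Hf w; have := indic01 A w.
by move=> /andP[? ?] /andP[? ?]; apply/andP; split; lra.
Qed.

Let indic_integrable A : measurable A ->
  P.-integrable setT (EFin \o (\1_A : T -> R)).
Proof.
move=> mA; apply: (@bounded_integrable _ _ _ _ _ 1) => // w.
by rewrite ger0_norm; case/andP: (indic01 A w).
Qed.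

Lemma approximable_measurable A : approximable A -> measurable A.
Proof. by case. Qed.

Let approximable0 : approximable set0.
Proof.
split=> // e e0; exists (cst 0) => //.
rewrite (_ : (fun _ => _) = cst 0); first by rewrite Rintegral_cst_prob.
by apply/funext => w; rewrite indic0 subr0 normr0.
Qed.

Let approximableC A : approximable A -> approximable (setT `\` A).
Proof.
rewrite setTD => -[mA AH]; split; first exact: measurableC.
move=> e /AH[f Hf fe]; exists (fun w => 1 - f w); first exact: H_compl.
apply: le_lt_trans fe; rewrite le_eqVlt; apply/orP; left; apply/eqP.
apply: eq_Rintegral => w _; rewrite -[RHS]normrN; congr `|_|.
by rewrite !indicE in_setC; case: (w \in A) => /=; ring.
Qed.

Let approximableU A B : approximable A -> approximable B ->
  approximable (A `|` B).
Proof.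
move=> [mA AH] [mB BH]; split; first exact: measurableU.
move=> e e0; have e20 : 0 < e / 2 by rewrite divr_gt0.
have [f Hf fe] := AH _ e20; have [g Hg ge] := BH _ e20.
exists (fun w => 1 - (1 - f w) * (1 - g w)).
  by apply: H_compl; apply: H_mul; exact: H_compl.
rewrite [ltRHS]splitr; apply: le_lt_trans (ltrD fe ge).
rewrite -RintegralD//; [|exact: dist_integrable..].
have Hfg : H (fun w => 1 - (1 - f w) * (1 - g w)).
  by apply: H_compl; apply: H_mul; exact: H_compl.
apply: le_Rintegral => //.
- by apply: dist_integrable => //; exact: measurableU.
- by apply: integrableD_EFin => //; exact: dist_integrable.
move=> w _.
have -> : \1_(A `|` B) w = 1 - (1 - \1_A w) * (1 - \1_B w) :> R.
  by rewrite !indicE in_setU; case: (w \in A); case: (w \in B) => /=; ring.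
rewrite (_ : _ - _ = (1 - \1_B w) * (\1_A w - f w) +
  (1 - f w) * (\1_B w - g w)); last by ring.
have := H01 Hf w; have := indic01 B w => /andP[? ?] /andP[? ?].
rewrite (le_trans (ler_normD _ _))// !normrM lerD// ler_piMl// ger0_norm; lra.
Qed.

Lemma approximable_ae A B : approximable A -> measurable B ->
  {ae P, forall w, A w <-> B w} -> approximable B.
Proof.
move=> [mA AH] mB AB; split => // e /AH[f Hf fe]; exists f => //.
apply: le_lt_trans fe; rewrite le_eqVlt; apply/orP; left; apply/eqP.
congr fine; apply: ae_eq_integral => //.
- exact: measurable_int (dist_integrable mB Hf).
- exact: measurable_int (dist_integrable mA Hf).
apply: filterS AB => w AB _ /=; rewrite !indicE.
by have -> : (w \in B) = (w \in A) by apply/idP/idP; rewrite !inE => /AB.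
Qed.

Lemma sigma_algebra_approximable : sigma_algebra setT approximable.
Proof.
split => // A AH; have mA n := approximable_measurable (AH n).
have mUA := bigcupT_measurable _ mA.
split=> // e e0; have e20 : 0 < e / 2 by rewrite divr_gt0.
(* Finite unions are approximable, and they exhaust the union up to a set of
   small probability. *)
pose B n := \big[setU/set0]_(i < n.+1) A i.
have BH n : approximable (B n).
  by rewrite /B; elim/big_ind: _ => // *; exact: approximableU.
have mB n := approximable_measurable (BH n).
have BUA : \bigcup_n B n = \bigcup_n A n by exact: bigcup_bigsetU_bigcup.
have mD n : measurable (\bigcup_n A n `\` B n) by exact: measurableD.
have [n Bn] : exists n, fine (P (\bigcup_n A n `\` B n)) < e / 2.
  have D0 : \bigcap_n (\bigcup_n A n `\` B n) = set0.
    apply/seteqP; split => // w wD; have [[k _ Ak]] := wD 0 I.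
    have [_] := wD k I; case; exact: (bigsetU_sup (ltnSn k) Ak).
  have : (P \o (fun n => \bigcup_n A n `\` B n)) n @[n --> \oo] --> 0%E.
    rewrite -(measure0 P) -D0; apply: nonincreasing_cvg_mu => //.
    - by rewrite -ge0_fin_numE// fin_num_measure.
    - by rewrite D0.
    move=> k l kl; apply/subsetPset; apply: setDS.
    exact: subset_bigsetU.
  move=> /fine_cvgP[_ /cvgrPdist_lt /(_ _ e20)][n _ /(_ n (leqnn n))].
  rewrite /= sub0r normrN ger0_norm ?fine_ge0//; exists n => //.
have [f Hf fe] := (BH n).2 _ e20; exists f => //.
rewrite [ltRHS]splitr.
have Bn' : \int[P]_w (\1_((\bigcup_n A n) `\` B n) w) < e / 2.
  by rewrite /Rintegral integral_indic// setIT.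
apply: le_lt_trans (ltrD Bn' fe).
rewrite -RintegralD//; [|exact: indic_integrable|exact: dist_integrable].
apply: le_Rintegral => //.
- exact: dist_integrable.
- by apply: integrableD_EFin => //;
    [exact: indic_integrable|exact: dist_integrable].
have BA : B n `<=` \bigcup_n A n by rewrite -BUA; exact: bigcup_sup.
move=> w _.
have -> : \1_(\bigcup_n A n `\` B n) w = \1_(\bigcup_n A n) w - \1_(B n) w :> R.
  rewrite !indicE in_setD; have [wB|wB] := boolP (w \in B n).
    by rewrite andbF mem_set ?subrr//; apply: BA; exact: set_mem.
  by rewrite andbT subr0.
rewrite (le_trans _ (_ : `|\1_(\bigcup_n A n) w - \1_(B n) w| +
  `|\1_(B n) w - f w| <= _))//.
  by rewrite (le_trans _ (ler_normD _ _))// subrKA.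
rewrite lerD2r ger0_norm// subr_ge0 !indicE ler_nat.
case: (boolP (w \in B n)) => // wB.
by rewrite mem_set//; apply: BA; exact: set_mem.
Qed.

(** For V bounded, both sides are continuous for the L^1(P) distance between
    indicators and test functions. *)
Lemma approximable_le (V : T -> R) (M c : R) A :
    measurable_fun setT V -> (forall w, 0 <= V w <= M) -> 0 <= c ->
    (forall f, H f -> \int[P]_w (f w * V w) <= c * \int[P]_w f w) ->
  approximable A ->
  \int[P]_w (\1_A w * V w) <= c * \int[P]_w \1_A w.
Proof.
move=> mV V0M c0 HV [mA AH]; apply/ler_addgt0Pr => e e0.
have w0 : T := point.
have M0 : 0 <= M by have /andP[] := V0M w0; exact: le_trans.
have cM0 : 0 < c + M + 1 by rewrite ltr_wpDl// addr_ge0.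
have r0 : 0 < e / (c + M + 1) by rewrite divr_gt0.
have [f Hf fr] := AH _ r0.
have mf := H_meas Hf; have f01 := H01 Hf.
have int_mulV (g : T -> R) :
    measurable_fun setT g -> (forall w, 0 <= g w <= 1) ->
    P.-integrable setT (EFin \o (fun w => g w * V w)).
  move=> mg g01; apply: (@bounded_integrable _ _ _ _ _ M) => [|w].
    exact: measurable_funM.
  have /andP[? ?] := g01 w; have /andP[? ?] := V0M w.
  by rewrite ger0_norm ?mulr_ge0// (le_trans (ler_piMl _ _)).
have intf : P.-integrable setT (EFin \o f).
  apply: (@bounded_integrable _ _ _ _ _ 1) => // w.
  by have /andP[? ?] := f01 w; rewrite ger0_norm.
have intd := dist_integrable mA Hf.
set D := \int[P]_w `|\1_A w - f w| in fr.
have le1 : \int[P]_w (\1_A w * V w) <= \int[P]_w (f w * V w) + M * D.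
  rewrite -RintegralZl// -RintegralD//; last 2 first.
    exact: int_mulV.
    exact: integrableZ_EFin.
  apply: le_Rintegral => //.
  - exact: int_mulV.
  - by apply: integrableD_EFin => //; [exact: int_mulV|exact: integrableZ_EFin].
  move=> w _; rewrite -lerBlDl -mulrBl mulrC (le_trans (ler_norm _))// normrM.
  by have /andP[V0 VM] := V0M w; rewrite (ger0_norm V0) ler_wpM2r.
have le2 : \int[P]_w f w <= \int[P]_w \1_A w + D.
  rewrite -RintegralD//; last exact: indic_integrable.
  apply: le_Rintegral => //.
    by apply: integrableD_EFin => //; exact: indic_integrable.
  by move=> w _; rewrite -lerBlDl distrC ler_norm.
apply: (le_trans le1); apply: le_trans (lerD (HV _ Hf) (lexx _)) _.
apply: le_trans (lerD (ler_wpM2l c0 le2) (lexx _)) _.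
rewrite mulrDr -addrA lerD2l -mulrDl.
have D0 : 0 <= D by apply: Rintegral_ge0.
rewrite (le_trans _ (_ : (c + M + 1) * (e / (c + M + 1)) <= _))//; last first.
  by rewrite mulrC divfK ?gt_eqF.
by rewrite ler_pM ?addr_ge0// ?lerDl// ltW.
Qed.

End approximable.

Import HBSimple HBNNSimple.

(** The inequality passes from indicators to simple functions by linearity, and
    to their increasing limits by monotone convergence. *)
Lemma le_integral_density (R : realType) d (T : measurableType d)
    (P : {measure set T -> \bar R}) (G : set (set T)) (U V : T -> R)
    (xi : T -> R) :
    sigma_algebra setT G -> G `<=` measurable ->
    measurable_fun setT U -> measurable_fun setT V ->
    (forall w, 0 <= U w) -> (forall w, 0 <= V w) ->
    (forall A, G A -> (\int[P]_w (\1_A w * V w)%:E <=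
                       \int[P]_w (\1_A w * U w)%:E)%E) ->
    @measurable_fun _ _ (g_sigma_algebraType G) R setT xi ->
    (forall w, 0 <= xi w) ->
  (\int[P]_w (xi w * V w)%:E <= \int[P]_w (xi w * U w)%:E)%E.
Proof.
move=> sG Gm mU mV U0 V0 UV mxi xi0.
have GE : @measurable _ (g_sigma_algebraType G) = G.
  exact: measurable_g_measurableTypeE.
have sub_meas (h : T -> R) :
    @measurable_fun _ _ (g_sigma_algebraType G) R setT h ->
    measurable_fun setT h.
  by move=> mh _ B mB; apply: Gm; rewrite -GE; exact: mh.
have mExi : @measurable_fun _ _ (g_sigma_algebraType G) (\bar R) setT
  (EFin \o xi) by exact/measurable_EFinP.
pose g_ := nnsfun_approx
  (measurableT : @measurable _ (g_sigma_algebraType G) setT) mExi.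
pose g n : T -> R := (g_ n : g_sigma_algebraType G -> R).
have mg n : measurable_fun setT (g n) by exact: sub_meas.
have g0 n w : 0 <= g n w by exact: fun_ge0.
have g_nd w : {homo (fun n => g n w) : n m / (n <= m)%N >-> n <= m}.
  by move=> n m nm; have /lefP := nd_nnsfun_approx measurableT mExi nm; exact.
have g_cvg w : g n w @[n --> \oo] --> xi w.
  have := @cvg_nnsfun_approx _ _ _ _ measurableT _ mExi
    (fun x _ => xi0 x : (0%E <= (xi x)%:E)%E) w I.
  by move=> /fine_cvg.
have sum_ge0 (X : T -> R) n : measurable_fun setT X -> (forall w, 0 <= X w) ->
    (\int[P]_w (g n w * X w)%:E = \sum_(y \in range (g n))
       (y%:E * \int[P]_w (\1_((g n) @^-1` [set y]) w * X w)%:E))%E.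
  move=> mX X0.
  have fin : finite_set (range (g n)) by exact: (@fimfunP _ _ (g_ n)).
  have range_ge0 y : range (g n) y -> 0 <= y by move=> [w _ <-].
  have E0 y w : (0 <= y%:E * (\1_((g n) @^-1` [set y]) w * X w)%:E)%E.
    rewrite EFinM muleA mule_ge0 ?lee_fin//.
    exact: (nnfun_muleindic_ge0 (g_ n)).
  transitivity (\int[P]_w (\sum_(y \in range (g n))
      (y%:E * (\1_((g n) @^-1` [set y]) w * X w)%:E)))%E.
    apply: eq_integral => w _.
    rewrite {1}(_ : g n w = \sum_(y \in range (g n))
        y * \1_((g n) @^-1` [set y]) w); last exact: (fimfunE (g_ n)).
    rewrite EFinM -fsumEFin// ge0_mule_fsuml//; last first.
      by move=> y; exact: (nnfun_muleindic_ge0 (g_ n)).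
    by apply: eq_fsbigr => y _; rewrite EFinM -muleA -EFinM.
  have mgy y : measurable ((g n) @^-1` [set y]).
    by rewrite -[X in measurable X]setTI; exact: mg.
  have m1 y : measurable_fun setT (fun w => \1_((g n) @^-1` [set y]) w * X w).
    by apply: measurable_funM => //; exact: measurable_indic.
  rewrite ge0_integral_fsum//; last first.
    move=> y; apply/measurable_EFinP; apply: measurable_funM => //.
  apply: eq_fsbigr => y; rewrite inE => /range_ge0 y0.
  rewrite ge0_integralZl_EFin//.
    by move=> w _; rewrite lee_fin mulr_ge0.
  exact/measurable_EFinP.
have step n : (\int[P]_w (g n w * V w)%:E <= \int[P]_w (xi w * U w)%:E)%E.
  apply: (@le_trans _ _ (\int[P]_w (g n w * U w)%:E)%E).
    rewrite !sum_ge0//; apply: lee_fsum => [|y [w _ <-]].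
      exact: (@fimfunP _ _ (g_ n)).
    by rewrite lee_wpmul2l ?lee_fin//; apply: UV; rewrite -GE.
  apply: ge0_le_integral => //.
  - by move=> w _; rewrite lee_fin mulr_ge0.
  - by apply/measurable_EFinP; exact: measurable_funM.
  - apply/measurable_EFinP; apply: measurable_funM => //; exact: sub_meas.
  move=> w _; rewrite lee_fin ler_wpM2r//.
  have := nondecreasing_cvgn_le (g_nd w) (cvgP _ (g_cvg w)) n.
  by rewrite (cvg_lim _ (g_cvg w)).
have cvgI : (\int[P]_w (g n w * V w)%:E)%E @[n --> \oo] -->
    (\int[P]_w (xi w * V w)%:E)%E.
  rewrite [X in _ --> X](_ : _ =
      (\int[P]_w limn (fun n => (g n w * V w)%:E))%E).
    apply: cvg_monotone_convergence => //.
    - by move=> n; apply/measurable_EFinP; exact: measurable_funM.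
    - by move=> n w _; rewrite lee_fin mulr_ge0.
    - by move=> w _ n m nm; rewrite lee_fin ler_wpM2r// g_nd.
  apply: eq_integral => w _; apply/esym/cvg_lim => //.
  by apply: cvg_EFin; [exact: nearW|apply: cvgMl; exact: g_cvg].
rewrite -(cvg_lim _ cvgI)//; apply: lime_le; first exact: cvgP cvgI.
exact: nearW.
Qed.

(** * The past enlarged by null sets *)

Section ramp.
Context {R : realType}.
Implicit Types a r s : R.

(** As n grows this increases to the indicator of ]a, +oo[. *)
Definition ramp a (n : nat) r : R := Num.min 1 (n%:R * Num.max 0 (r - a)).

Lemma ramp01 a n r : 0 <= ramp a n r <= 1.
Proof.
rewrite /ramp le_min ler01 mulr_ge0//=; first by rewrite ge_min lexx.
by rewrite le_max lexx.
Qed.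

Lemma ramp_lipschitz a n r s : `|ramp a n r - ramp a n s| <= n%:R * `|r - s|.
Proof.
have n0 : 0 <= n%:R :> R by [].
have H1 := ler_wpM2l n0 (ler_norm (r - s)).
have H2 := ler_wpM2l n0 (ler_norm (s - r)); rewrite (distrC s) in H2.
have H0 : 0 <= n%:R * `|r - s| by rewrite mulr_ge0.
rewrite ler_norml /ramp.
have [ra|ra] := leP 0 (r - a); have [sa|sa] := leP 0 (s - a);
  rewrite !minElt; case: ltP => P1; case: ltP => P2; apply/andP; split; nra.
Qed.

Lemma cvg_ramp a r : ramp a n r @[n --> \oo] --> ((a < r)%R%:R : R).
Proof.
case: ltP => [ar|ra].
  apply: cvg_near_cst; near=> n; rewrite /ramp min_l// max_r ?subr_ge0 1?ltW//.
  rewrite -ltr_pdivrMr ?subr_gt0// mul1r.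
  by near: n; exact: nbhs_infty_gtr.
apply: cvg_near_cst; apply: nearW => n.
by rewrite /ramp max_l ?subr_le0// mulr0 min_r.
Unshelve. all: by end_near. Qed.

End ramp.

Section past.
Context {R : realType} {disp : measure_display} {Omega : measurableType disp}.
Context {Theta : Type} {d N : nat}.
Hypothesis hTheta : inhabited Theta.
Variable F : Theta -> probability (borelM R d 1) R.
Variable W : nat -> Omega -> 'cV[R]_d.
Hypothesis hFN : @measurable _ Omega = Fk W N.
Hypothesis W_Lc : assumption_W N F W.
Hypothesis A3 : assumption_A3 N F W.
Variable P : probability Omega R.
Hypothesis PP : calP N F W P.

Definition past_tests k : set (Omega -> R) :=
  [set f | exists phi : 'M[R]_(d, N) -> R, [/\ CbLip phi,
     forall x, 0 <= phi x <= 1, depends_on k phi & f = phi \o Wmx W N]].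

(** A sigma-algebra that contains F_k and is stable under changes on P-null
    sets, so that classes modulo polar sets can be handled as measurable
    functions, and on which inequalities can still be tested with bounded
    Lipschitz functions of the first k noises. *)
Definition past k : set (set Omega) := approximable P (past_tests k).

Let tests_meas k f : past_tests k f -> measurable_fun setT f.
Proof.
move=> [phi [cphi _ _ ->]].
exact: measurableT_comp (CbLip_measurable cphi) (Wmx_measurable W_Lc).
Qed.

Let tests01 k f : past_tests k f -> forall w, 0 <= f w <= 1.
Proof. by move=> [phi [_ phi01 _ ->]] w; exact: phi01. Qed.

Let tests_cst0 k : past_tests k (cst 0).
Proof.
exists (cst 0); split => //; first exact: CbLip_cst.
by move=> x; rewrite lexx ler01.
Qed.

Let tests_compl k f : past_tests k f -> past_tests k (fun w => 1 - f w).
Proof.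
move=> [phi [cphi phi01 phik ->]]; exists (fun x => 1 - phi x); split => //.
- by apply: CbLipB => //; exact: CbLip_cst.
- by move=> x; have /andP[? ?] := phi01 x; apply/andP; split; lra.
- by move=> x x' xx'; rewrite (phik _ _ xx').
Qed.

Let tests_mul k f g : past_tests k f -> past_tests k g ->
  past_tests k (fun w => f w * g w).
Proof.
move=> [phi [cphi phi01 phik ->]] [psi [cpsi psi01 psik ->]].
exists (fun x => phi x * psi x); split => //.
- exact: CbLipM.
- move=> x; have /andP[? ?] := phi01 x; have /andP[? ?] := psi01 x.
  by rewrite mulr_ge0//= mulr_ile1.
- by move=> x x' xx'; rewrite (phik _ _ xx') (psik _ _ xx').
Qed.

Lemma past_sigma_algebra k : sigma_algebra setT (past k).
Proof.
apply: sigma_algebra_approximable.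
- exact: tests_meas.
- exact: tests01.
- exact: tests_cst0.
- exact: tests_compl.
- exact: tests_mul.
Qed.

Lemma past_sub_measurable k : past k `<=` measurable.
Proof. by move=> A []. Qed.

Lemma measurable_pastE k :
  @measurable _ (g_sigma_algebraType (past k)) = past k.
Proof. exact/measurable_g_measurableTypeE/past_sigma_algebra. Qed.

Lemma pastS k l : (k <= l)%N -> past k `<=` past l.
Proof.
move=> kl A [mA AH]; split=> // e /AH[_ [phi [cphi phi01 phik ->]] fe].
exists (phi \o Wmx W N) => //; exists phi; split => // x x' xx'.
by apply: phik => i j jk; apply: xx'; exact: leq_trans kl.
Qed.

Definition past_fun k (X : Omega -> R) : Prop :=
  @measurable_fun _ _ (g_sigma_algebraType (past k)) R setT X.

Lemma past_funS k l X : (k <= l)%N -> past_fun k X -> past_fun l X.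
Proof.
move=> kl mX _ B mB; rewrite measurable_pastE; apply: (pastS kl).
by rewrite -measurable_pastE; exact: mX.
Qed.

Lemma past_fun_measurable k X : past_fun k X -> measurable_fun setT X.
Proof.
move=> mX _ B mB; apply: (@past_sub_measurable k).
by rewrite -measurable_pastE; exact: mX.
Qed.

Let ray_past k (j : 'I_N) i a : (j < k)%N -> past k [set w | a < W j.+1 w i 0].
Proof.
move=> jk.
have mW := W_measurable W_Lc i (ltn_ord j).
have mA : measurable [set w | a < W j.+1 w i 0].
  rewrite -[X in measurable X]setTI (_ : [set w | _] =
    (fun w => W j.+1 w i 0) @^-1` `]a, +oo[%classic).
    by apply: mW => //; exact: measurable_itv.
  by apply/seteqP; split => w /=; rewrite in_itv/= andbT.
split=> // e e0.
pose f n w := ramp a n (W j.+1 w i 0).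
have cramp n : CbLip (fun x : 'M[R]_(d, N) => ramp a n (x i j)).
    apply: (CbLip_entry (C := 1) (D := n%:R)) => [r|r s].
      by have /andP[? ?] := ramp01 a n r; rewrite ger0_norm.
    exact: ramp_lipschitz.
have mf n : measurable_fun setT (f n).
  have := measurableT_comp (CbLip_measurable (cramp n)) (Wmx_measurable W_Lc).
  by congr (measurable_fun _ _); apply/funext => w /=; rewrite mxE.
have fcvg w : f n w @[n --> \oo] --> (\1_[set w | a < W j.+1 w i 0] w : R).
  rewrite indicE (_ : _ \in _ = (a < W j.+1 w i 0)); first exact: cvg_ramp.
  by apply/idP/idP; rewrite inE.
have f01 n w : 0 <= f n w <= 1 by exact: ramp01.
set A := [set w | _] in mA fcvg *.
have h_le1 n w : `|\1_A w - f n w| <= 1.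
  have /andP[? ?] := f01 n w; rewrite indicE; case: (w \in A);
    by rewrite ler_norml; apply/andP; split => /=; lra.
have mh n : measurable_fun setT (fun w => `|\1_A w - f n w|).
  apply: measurableT_comp => //; apply: measurable_funB => //.
have hcvg w : `|\1_A w - f n w| @[n --> \oo] --> (0 : R).
  rewrite -(normr0 R) -(subrr (\1_A w)); apply: cvg_norm.
  by apply: cvgB; [exact: cvg_cst|exact: fcvg].
have le1E n w : (`|(`|\1_A w - f n w|)%:E| <= 1)%E.
  by rewrite lee_fin normr_id.
have cE w : (`|\1_A w - f n w|)%:E @[n --> \oo] --> 0%E.
  by apply: cvg_EFin; [exact: nearW|exact: hcvg].
have hint n : P.-integrable setT (EFin \o (fun w => `|\1_A w - f n w|)).
  by apply: (@bounded_integrable _ _ _ _ _ 1) => // w; rewrite normr_id.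
have [_ _] := @dominated_convergence _ _ _ P setT measurableT
  (fun n w => (`|\1_A w - f n w|)%:E) (cst 0%E) (cst 1%E)
  (fun n => measurable_int P (hint n)) (measurable_cst _)
  (aeW _ (fun w _ => cE w))
  (finite_measure_integrable_cst P 1 measurableT)
  (aeW _ (fun w n _ => le1E n w)).
rewrite integral_cst// mul0e => /fine_cvgP[_ /cvgrPdist_lt /(_ _ e0)].
move=> [n _ /(_ n (leqnn n))] /=; rewrite sub0r normrN => ne.
exists (f n); last by apply: le_lt_trans ne; exact: ler_norm.
exists (fun x => ramp a n (x i j)); split => //.
- by move=> x; exact: ramp01.
- by move=> x x' xx'; rewrite xx'.
- by apply/funext => w; rewrite /f /= mxE.
Qed.

(** It suffices that the rays of the coordinates of W_1, ..., W_k are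
    approximable, as the Borel sets of vectors are generated by coordinates. *)
Lemma Fk_past k : (k <= N)%N -> Fk W k `<=` past k.
Proof.
move=> kN; apply: smallest_sub; first exact: past_sigma_algebra.
move=> _ [j [B [/andP[+ +] mB ->]]]; case: j => // j _ jk.
have jN : (j < N)%N := leq_trans jk kN.
rewrite -measurable_pastE -[X in measurable X]setTI.
have mW : @measurable_fun _ _ (g_sigma_algebraType (past k)) (borelM R d 1)
    setT (W j.+1).
  apply: measurable_fun_matrix => i l; rewrite ord1.
  apply: (measurability _ (RGenOInfty.measurableE R)) => _ [_ [a ->] <-].
  rewrite setTI measurable_pastE.
  have := @ray_past k (Ordinal jN) i a jk; congr (past _ _).
  by apply/seteqP; split => w /=; rewrite in_itv/= andbT.
exact: mW.
Qed.

Lemma past_fun_ae k X Y : past_fun k X -> measurable_fun setT Y ->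
  {ae P, forall w, X w = Y w} -> past_fun k Y.
Proof.
move=> mX mY XY _ B mB; rewrite setTI measurable_pastE.
apply: (@approximable_ae _ _ _ P _ (@tests_meas k) (@tests01 k) (X @^-1` B)).
- by have := mX measurableT B mB; rewrite setTI measurable_pastE.
- by rewrite -[X in measurable X]setTI; exact: mY.
- by apply: filterS XY => w /= ->.
Qed.

Lemma past_fun_Lc p k X : (k <= N)%N -> Lc N F W p k X -> past_fun k X.
Proof.
move=> kN [mX [Y [XY mY _ _]]].
apply: (@past_fun_ae _ Y) => //.
  move=> _ B mB; rewrite measurable_pastE; apply: (Fk_past kN); exact: mY.
by apply: filterS (qs_eq_ae PP XY) => w ->.
Qed.

Lemma past_fun_W k i : (k < N)%N -> past_fun k.+1 (fun w => W k.+1 w i 0).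
Proof. by move=> kN; apply: (past_fun_Lc (p := 2)) => //; exact: W_Lc. Qed.

(** Domination is applied to bounded Lipschitz truncations of the square of the
    noise, with a constant independent of the truncation; monotone convergence
    then removes the truncation. *)
Lemma past_second_moment k i : (k < N)%N ->
  exists2 C : R, 0 <= C & forall xi, past_fun k xi -> (forall w, 0 <= xi w) ->
    (\int[P]_w (xi w * (W k.+1 w i 0) ^+ 2)%:E <= \int[P]_w (xi w * C)%:E)%E.
Proof.
move=> kN; have [C0 FC0] := F_moment hTheta hFN W_Lc (Ordinal kN) i A3.
(* The constant of F_moment is not known to be nonnegative. *)
pose C := Num.max 0 C0; have C_ge0 : 0 <= C by rewrite le_max lexx.
exists C => // xi mxi xi0.
have mW := W_measurable W_Lc i kN.
apply: (le_integral_density (past_sigma_algebra k)) => //.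
- exact: past_sub_measurable.
- exact: measurable_funX.
- by move=> w; exact: sqr_ge0.
move=> A pA; have mA := past_sub_measurable pA.
have cS n : CbLip (fun y : 'cV[R]_d => sqtrunc n%:R (y i 0)).
  apply: (CbLip_entry (C := n%:R ^+ 2) (D := 2 * n%:R)) => [r|r s].
    exact: sqtrunc_bound.
  exact: sqtrunc_lipschitz.
pose V n w := sqtrunc n%:R (W k.+1 w i 0).
have mV n : measurable_fun setT (V n).
  have mWk : measurable_fun setT (W k.+1 : Omega -> borelM R d 1).
    apply: measurable_fun_matrix => i' l; rewrite ord1.
    exact: (W_measurable W_Lc).
  exact: measurableT_comp (CbLip_measurable (cS n)) mWk.
have V0M n w : 0 <= V n w <= n%:R ^+ 2.
  by rewrite sqtrunc_ge0/= (le_trans (ler_norm _))// sqtrunc_bound.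
have indic_le1 w : `|\1_A w| <= 1 :> R.
  by rewrite indicE; case: (w \in A); rewrite ?normr1 ?normr0.
have truncA n : (\int[P]_w (\1_A w * V n w)%:E <=
                \int[P]_w (\1_A w * C)%:E)%E.
  have HV f : past_tests k f ->
      \int[P]_w (f w * V n w) <= C * \int[P]_w f w.
    move=> [phi [cphi phi01 phik ->]].
    apply: (one_step_domination (k := Ordinal kN) hTheta W_Lc PP cphi (cS n)).
    - by move=> x; have /andP[] := phi01 x.
    - exact: phik.
    - by move=> theta; rewrite le_max FC0 ?orbT.
  have := @approximable_le _ _ _ P (past_tests k) (@tests_meas k) (@tests01 k)
    (V n) (n%:R ^+ 2) C A (mV n) (V0M n) C_ge0 HV pA.
  rewrite mulrC -RintegralZr//; last first.
    exact: (@bounded_integrable _ _ _ _ _ 1).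
  rewrite -lee_fin -!EFin_Rintegral//.
    apply: (@bounded_integrable _ _ _ _ _ C) => [|w].
      exact: measurable_funM.
    by rewrite normrM (ger0_norm C_ge0) ler_piMl.
  apply: (@bounded_integrable _ _ _ _ _ (n%:R ^+ 2)) => [|w].
    exact: measurable_funM.
  have /andP[V0 VM] := V0M n w.
  by rewrite normrM (ger0_norm V0) (le_trans _ VM)// ler_piMl.
have V_nd w : {homo (fun n => V n w) : n m / (n <= m)%N >-> n <= m}.
  exact: sqtrunc_nd.
have cvgI : (\int[P]_w (\1_A w * V n w)%:E)%E @[n --> \oo] -->
    (\int[P]_w (\1_A w * W k.+1 w i 0 ^+ 2)%:E)%E.
  rewrite [X in _ --> X](_ : _ =
      (\int[P]_w limn (fun n => (\1_A w * V n w)%:E))%E).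
    apply: cvg_monotone_convergence => //.
    - by move=> n; apply/measurable_EFinP; exact: measurable_funM.
    - by move=> n w _; rewrite lee_fin mulr_ge0//; have /andP[] := V0M n w.
    - by move=> w _ n m nm; rewrite lee_fin ler_wpM2l//; exact: V_nd.
  apply: eq_integral => w _; apply/esym/cvg_lim => //.
  apply: cvg_EFin; first exact: nearW.
  by apply: cvgMr; exact: cvg_sqtrunc.
rewrite -(cvg_lim _ cvgI)//; apply: lime_le; first exact: cvgP cvgI.
exact: nearW.
Qed.

End past.

(** * Functions differentiable within a set *)

Section derivative_within.
Context {R : realType} {p q : nat}.
Implicit Types (D : set 'cV[R]_p) (g : 'cV[R]_p -> 'cV[R]_q) (J : 'M[R]_(q, p)).

Lemma jacobian_withinE D g z J : jacobian_within D g z J ->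
  forall eps : R, 0 < eps -> exists2 r : R, 0 < r & forall y, D y ->
    (forall j, `|y j 0 - z j 0| < r) -> forall i,
    `|g y i 0 - g z i 0 - \sum_j J i j * (y j 0 - z j 0)| <=
      eps * \sum_j `|y j 0 - z j 0|.
Proof.
move=> gJ eps eps0; have := gJ _ eps0.
rewrite /within/= => /nbhs_ballP[r /= r0 rD].
exists r => // y Dy yz i.
have : ball z r y.
  by split => // j k; rewrite ord1 /ball/= distrC.
move=> /rD /(_ Dy) yE.
have -> : g y i 0 - g z i 0 - \sum_j J i j * (y j 0 - z j 0) =
    (g y - g z - J *m (y - z)) i 0.
  by rewrite !mxE; congr (_ - _); apply: eq_bigr => j _; rewrite !mxE.
apply: le_trans (ler_enorm_entry _ _ _) _; apply: le_trans yE _.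
rewrite ler_wpM2l ?(ltW eps0)// (le_trans (ler_enorm_sum _))//.
by apply: ler_sum => j _; rewrite big_ord1 !mxE.
Qed.

Lemma jacobian_within_continuous D g z J : jacobian_within D g z J ->
  forall eps : R, 0 < eps -> exists2 r : R, 0 < r & forall y, D y ->
    (forall j, `|y j 0 - z j 0| < r) -> forall i, `|g y i 0 - g z i 0| < eps.
Proof.
move=> /jacobian_withinE/(_ 1 ltr01)[r r0 rD] eps eps0.
pose K : R := \sum_i \sum_j `|J i j|.
have K0 : 0 <= K by apply: sumr_ge0 => ? _; apply: sumr_ge0.
have K1 : 0 < (K + 1) * p.+1%:R by rewrite mulr_gt0// ltr_wpDl.
exists (Num.min r (eps / ((K + 1) * p.+1%:R))).
  by rewrite lt_min r0 divr_gt0.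
move=> y Dy yz i.
have yr j : `|y j 0 - z j 0| < r.
  by apply: lt_le_trans (yz j) _; rewrite ge_min lexx.
have ye j : `|y j 0 - z j 0| <= eps / ((K + 1) * p.+1%:R).
  by apply/ltW/(lt_le_trans (yz j)); rewrite ge_min lexx orbT.
have := rD _ Dy yr i; rewrite mul1r.
set S := \sum_j `|_|; set JS := \sum_j _ => gS.
have S_ge0 : 0 <= S by exact: sumr_ge0.
have JSK : `|JS| <= K * S.
  rewrite (le_trans (ler_norm_sum _ _ _))// mulr_sumr; apply: ler_sum => j _.
  rewrite normrM ler_wpM2r// /K (bigD1 i)//= (bigD1 j)//= -addrA lerDl.
  by rewrite addr_ge0// sumr_ge0// => ? _; rewrite sumr_ge0.
rewrite (@le_lt_trans _ _ ((K + 1) * S))//.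
  rewrite mulrDl mul1r -(subrK JS (_ - _)) (le_trans (ler_normD _ _))//.
  by rewrite addrC lerD.
have SE : S <= p%:R * (eps / ((K + 1) * p.+1%:R)).
  have -> : p%:R * (eps / ((K + 1) * p.+1%:R)) =
      \sum_(j < p) (eps / ((K + 1) * p.+1%:R)).
    by rewrite sumr_const card_ord mulr_natl.
  exact: ler_sum.
rewrite (@le_lt_trans _ _ ((K + 1) * (p%:R * (eps / ((K + 1) * p.+1%:R)))))//.
  by rewrite ler_wpM2l// addr_ge0.
have -> : (K + 1) * (p%:R * (eps / ((K + 1) * p.+1%:R))) =
    eps * (p%:R / p.+1%:R).
  by field; rewrite nat1r pnatr_eq0/= gt_eqF// ltr_wpDl.
by rewrite gtr_pMr// ltr_pdivrMr// mul1r ltr_nat.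
Qed.

(** The mean value theorem is applied to one coordinate of g along the segment
    from z' to z, on which the derivative within D is an ordinary one. *)
Lemma mean_value_within D g (J : 'cV[R]_p -> 'M[R]_(q, p)) (L : R) z z' i :
    (forall t : R, 0 <= t <= 1 -> D (z' + t *: (z - z'))) ->
    (forall y, D y -> jacobian_within D g y (J y)) ->
    (forall y j, D y -> `|J y i j| <= L) ->
  `|g z i 0 - g z' i 0| <= L * \sum_j `|z j 0 - z' j 0|.
Proof.
move=> Dseg gJ JL.
pose c (t : R) := z' + t *: (z - z').
have cE t j : c t j 0 = z' j 0 + t * (z j 0 - z' j 0) by rewrite !mxE.
have cB t s j : c t j 0 - c s j 0 = (t - s) * (z j 0 - z' j 0).
  by rewrite !cE; ring.
pose f (t : R) := g (c t) i 0.
pose df (t : R) := \sum_j J (c t) i j * (z j 0 - z' j 0).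
pose S := \sum_j `|z j 0 - z' j 0|.
have S0 : 0 <= S by exact: sumr_ge0.
have close (r : R) : 0 < r -> exists2 s, 0 < s & forall t t', `|t - t'| < s ->
    forall j, `|c t j 0 - c t' j 0| < r.
  move=> r0; exists (r / (S + 1)); first by rewrite divr_gt0// ltr_wpDl.
  move=> t t' tt' j; rewrite cB normrM.
  have zS : `|z j 0 - z' j 0| <= S.
    by rewrite /S (bigD1 j)//= lerDl sumr_ge0.
  rewrite (@le_lt_trans _ _ (`|t - t'| * (S + 1)))//.
    by rewrite ler_wpM2l// (le_trans zS)// lerDl.
  by rewrite -ltr_pdivlMr// ltr_wpDl.
have f_derive (t : R) : t \in `]0, 1[ -> is_derive t 1 f (df t).
  rewrite in_itv/= => /andP[t0 t1].
  have Dt : D (c t) by apply: Dseg; rewrite !ltW.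
  suff : h^-1 *: ((f \o shift t) (h *: 1) - f t) @[h --> 0^'] --> df t.
    by move=> fdf; apply: DeriveDef; [exact: cvgP fdf|exact: cvg_lim fdf].
  apply/cvgrPdist_le => e e0.
  have eS : 0 < e / (S + 1) by rewrite divr_gt0// ltr_wpDl.
  have [r r0 rD] := jacobian_withinE (gJ _ Dt) eS.
  have [s s0 cs] := close _ r0.
  near=> h.
  have h0 : h != 0 by near: h; exact: nbhs_dnbhs_neq.
  have hs : `|h| < s by near: h; apply: dnbhs0_lt.
  have ht : `|h| < Num.min t (1 - t).
    by near: h; apply: dnbhs0_lt; rewrite lt_min t0 subr_gt0.
  have Dth : D (c (h + t)).
    move: ht; rewrite lt_min !ltr_norml => /andP[/andP[? ?] /andP[? ?]].
    by apply: Dseg; apply/andP; split; lra.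
  have := rD _ Dth (cs _ _ _) i; rewrite addrK => /(_ hs) gE.
  rewrite /= [h *: 1]mulr1 distrC.
  rewrite (_ : _ - df t = h^-1 * (f (h + t) - f t - h * df t)); last first.
    by rewrite mulrBr mulKf.
  rewrite normrM normfV ler_pdivrMl ?normr_gt0//.
  have -> : h * df t = \sum_j J (c t) i j * (c (h + t) j 0 - c t j 0).
    by rewrite /df mulr_sumr; apply: eq_bigr => j _; rewrite cB addrK mulrCA.
  apply: le_trans gE _.
  have -> : \sum_j `|c (h + t) j 0 - c t j 0| = `|h| * S.
    by rewrite /S mulr_sumr; apply: eq_bigr => j _; rewrite cB addrK normrM.
  rewrite mulrCA ler_wpM2l// -mulrA ler_piMr ?(ltW e0)//.
  by rewrite ler_pdivrMl ?mulr1 ?lerDl// ltr_wpDl.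
have f_cont : {within `[0, 1], continuous f}.
  apply/subspace_continuousP => t; rewrite /= in_itv/= => t01.
  have Dt : D (c t) by exact: Dseg.
  apply/cvgrPdist_lt => e e0.
  have [r r0 rD] := jacobian_within_continuous (gJ _ Dt) e0.
  have [s s0 cs] := close _ r0.
  apply/nbhs_ballP; exists s => //= t' tt'; rewrite /= in_itv/= => t'01.
  rewrite distrC; apply: rD; first exact: Dseg.
  by apply: cs; rewrite distrC.
have [t t01] := MVT ltr01 f_derive f_cont.
rewrite subr0 mulr1 /f.
have -> : c 1 = z by rewrite /c scale1r addrC subrK.
have -> : c 0 = z' by rewrite /c scale0r addr0.
move=> ->; rewrite /df (le_trans (ler_norm_sum _ _ _))// mulr_sumr.
apply: ler_sum => j _; rewrite normrM ler_wpM2r//; apply: JL; apply: Dseg.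
by move: t01; rewrite in_itv/= => /andP[? ?]; rewrite !ltW.
Unshelve. all: by end_near. Qed.

End derivative_within.

(** * Measurability of coefficients along a process *)

(** A function measurable in w and continuous in z is measurable along a
    measurable selection z = h w. The domain D need not be a measurable set, so
    h is replaced by a representative in D of its cell in a fine grid. *)
Lemma measurable_fun_caratheodory (R : realType) d (T : measurableType d) p
    (D : set 'cV[R]_p) (g : 'cV[R]_p -> T -> R) (h : T -> 'cV[R]_p) :
    (forall z, D z -> measurable_fun setT (g z)) ->
    (forall w z, D z -> forall eps : R, 0 < eps ->
       exists2 r : R, 0 < r & forall y, D y ->
         (forall j, `|y j 0 - z j 0| < r) -> `|g y w - g z w| < eps) ->
    (forall j, measurable_fun setT (fun w => h w j 0)) ->
    (forall w, D (h w)) ->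
  measurable_fun setT (fun w => g (h w) w).
Proof.
move=> mg cg mh Dh.
(* rep n c is a point of D in the cell c of the grid of mesh 1 / (n + 1). *)
pose cell n (z : 'cV[R]_p) : 'cV[int]_p :=
  \col_j Num.floor (n.+1%:R * z j 0).
pose rep n c := xget (h point) [set z | D z /\ cell n z = c].
have Drep n c : D (rep n c).
  by rewrite /rep; case: xgetP => [z _ []|_].
have cell_rep n w : cell n (rep n (cell n (h w))) = cell n (h w).
  rewrite /rep; case: xgetP => [z _ []//|/(_ (h w))].
  by case; split.
have rep_close n w j : `|rep n (cell n (h w)) j 0 - h w j 0| < n.+1%:R^-1.
  have := cell_rep n w => /matrixP/(_ j 0); rewrite !mxE.
  set a := rep _ _ _ _; set b := h w j 0 => ab.
  have := floor_itv (n.+1%:R * a); have := floor_itv (n.+1%:R * b).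
  rewrite ab !intrD => /andP[b1 b2] /andP[a1 a2].
  have n0 : 0 < n.+1%:R :> R by [].
  rewrite -(@ltr_pM2l _ n.+1%:R)// divff ?gt_eqF//.
  rewrite -[X in X * _](ger0_norm (ltW n0)) -normrM mulrBr ltr_norml.
  by apply/andP; split; lra.
have mcell n c : measurable [set w | cell n (h w) = c].
  rewrite (_ : [set w | _] = \bigcap_(j in [set: 'I_p])
     ((fun w => n.+1%:R * h w j 0) @^-1` `[(c j 0)%:~R, (c j 0 + 1)%:~R[)).
    apply: fin_bigcap_measurable => // j _.
    rewrite -[X in measurable X]setTI.
    by apply: measurable_funM => //; exact: measurable_itv.
  apply/seteqP; split => [w /= <- j _ /=|w wc /=].
    by rewrite in_itv/= mxE floor_itv.
  apply/matrixP => j k; rewrite ord1 mxE; apply/eqP; rewrite floor_eq.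
  by have := wc j I; rewrite /= in_itv.
apply: (measurable_fun_cvg (h := fun n w => g (rep n (cell n (h w))) w)).
  move=> n _ B mB; rewrite setTI.
  rewrite (_ : _ @^-1` B = \bigcup_c ([set w | cell n (h w) = c] `&`
      (g (rep n c)) @^-1` B)).
    apply: countable_bigcupT_measurable => // c; apply: measurableI => //.
    by rewrite -[X in measurable X]setTI; exact: mg.
  apply/seteqP; split => [w Bw|w [c _ [/= <-]]//].
  by exists (cell n (h w)).
move=> w _; apply/cvgrPdist_lt => e e0.
have [r r0 rD] := cg w _ (Dh w) _ e0.
near=> n; rewrite distrC; apply: rD => // j.
apply: lt_trans (rep_close n w j) _.
near: n; exact: near_infty_natSinv_lt (PosNum r0).
Unshelve. all: by end_near. Qed.

Lemma jacobian_within_partial (R : realType) p q (D : set 'cV[R]_p)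
    (g : 'cV[R]_p -> 'cV[R]_q) z (J : 'M[R]_(q, p)) i j :
    jacobian_within D g z J ->
    (forall n, D (z + n.+1%:R^-1 *: delta_mx j 0)) ->
  n.+1%:R * (g (z + n.+1%:R^-1 *: delta_mx j 0) i 0 - g z i 0) @[n --> \oo] -->
    J i j.
Proof.
move=> gJ Dn; apply/cvgrPdist_le => e e0.
have [r r0 rD] := jacobian_withinE gJ e0.
near=> n.
have n0 : 0 < n.+1%:R :> R by [].
have yE k : (z + n.+1%:R^-1 *: delta_mx j 0) k 0 - z k 0 =
    n.+1%:R^-1 * (k == j)%:R.
  by rewrite !mxE andbT addrAC subrr add0r.
have yr k : `|(z + n.+1%:R^-1 *: delta_mx j 0) k 0 - z k 0| < r.
  rewrite yE (@le_lt_trans _ _ n.+1%:R^-1)//.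
    by case: (k == j); rewrite ?mulr1 ?mulr0 ?normr0 ?ger0_norm ?invr_ge0.
  near: n; exact: near_infty_natSinv_lt (PosNum r0).
have := rD _ (Dn n) yr i.
rewrite (bigD1 j)//= big1 => [|k kj]; last by rewrite yE (negbTE kj) !mulr0.
rewrite yE eqxx mulr1 addr0.
rewrite (bigD1 j)//= big1 => [|k kj]; last first.
  by rewrite yE (negbTE kj) mulr0 normr0.
rewrite yE eqxx mulr1 addr0 normfV (ger0_norm (ltW n0)) => gE.
rewrite -(ler_pM2r (_ : 0 < n.+1%:R^-1)) ?invr_gt0//; apply: le_trans gE.
rewrite -[X in _ * X](@ger0_norm _ n.+1%:R^-1) ?invr_ge0// -normrM distrC.
by rewrite mulrBl mulrAC divff ?gt_eqF// mul1r.
Unshelve. all: by end_near. Qed.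

(** A derivative is a limit of difference quotients, hence measurable along
    h in every direction in which D allows small steps. *)
Lemma jacobian_measurable (R : realType) d (T : measurableType d) p q
    (D : set 'cV[R]_p) (g : 'cV[R]_p -> T -> 'cV[R]_q)
    (J : 'cV[R]_p -> T -> 'M[R]_(q, p)) (h : T -> 'cV[R]_p) i j :
    (forall w z, D z -> jacobian_within D (g^~ w) z (J z w)) ->
    (forall z, D z -> measurable_fun setT (fun w => g z w i 0)) ->
    (forall l, measurable_fun setT (fun w => h w l 0)) ->
    (forall w, D (h w)) ->
    (forall k w, D (h w + k.+1%:R^-1 *: delta_mx j 0)) ->
  measurable_fun setT (fun w => J (h w) w i j).
Proof.
move=> gJ mg mh Dh Dhj.
have along (h' : T -> 'cV[R]_p) :
    (forall l, measurable_fun setT (fun w => h' w l 0)) ->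
    (forall w, D (h' w)) -> measurable_fun setT (fun w => g (h' w) w i 0).
  move=> mh' Dh'.
  apply: (@measurable_fun_caratheodory _ _ _ _ D (fun z w => g z w i 0)) => //.
  move=> w z Dz eps eps0.
  have [r r0 rD] := jacobian_within_continuous (gJ w z Dz) eps0.
  by exists r => // y Dy yz; exact: rD.
apply: (measurable_fun_cvg (h := fun k w =>
    k.+1%:R * (g (h w + k.+1%:R^-1 *: delta_mx j 0) w i 0 - g (h w) w i 0))).
  move=> k; apply: measurable_funM => //; apply: measurable_funB.
    apply: along => // l; under eq_fun do rewrite !mxE.
    exact: measurable_funD.
  exact: along.
by move=> w _; exact: (jacobian_within_partial (gJ w _ (Dh w)) (Dhj ^~ w)).
Qed.

Section coefficients.
Context {R : realType} {d : measure_display} {T : measurableType d}.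
Context {n m q : nat}.
Variables (V : set 'cV[R]_m) (G : 'cV[R]_n -> 'cV[R]_m -> T -> 'cV[R]_q).
Variables (G_x : 'cV[R]_n -> 'cV[R]_m -> T -> 'M[R]_(q, n)).
Variables (G_u : 'cV[R]_n -> 'cV[R]_m -> T -> 'M[R]_(q, m)).
Hypothesis G_diff : forall w, jacobian_xu V (fun x u => G x u w)
  (fun x u => G_x x u w) (fun x u => G_u x u w).

Let D : set 'cV[R]_(n + m) := [set z | V (dsubmx z)].

Let jac w z : D z -> jacobian_within D
  (fun z => G (usubmx z) (dsubmx z) w) z
  (row_mx (G_x (usubmx z) (dsubmx z) w) (G_u (usubmx z) (dsubmx z) w)).
Proof.
by move=> Dz; have := @G_diff w (usubmx z) (dsubmx z) Dz; rewrite vsubmxK.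
Qed.

Let selection_measurable (x : T -> 'cV[R]_n) (u : T -> 'cV[R]_m) :
    (forall j, measurable_fun setT (fun w => x w j 0)) ->
    (forall j, measurable_fun setT (fun w => u w j 0)) ->
    (forall w, V (u w)) ->
  (forall j, measurable_fun setT (fun w => col_mx (x w) (u w) j 0)) /\
  (forall w, D (col_mx (x w) (u w))).
Proof.
move=> mx mu Vu; split => [j|w]; last by rewrite /D/= col_mxKd.
case: (splitP j) => k jk.
  rewrite (_ : j = lshift m k); last exact: val_inj.
  by under eq_fun do rewrite col_mxEu; exact: mx.
rewrite (_ : j = rshift n k); last exact: val_inj.
by under eq_fun do rewrite col_mxEd; exact: mu.
Qed.

Lemma coefficient_measurable (x : T -> 'cV[R]_n) (u : T -> 'cV[R]_m) i :
    (forall x v, V v -> measurable_fun setT (fun w => G x v w i 0)) ->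
    (forall j, measurable_fun setT (fun w => x w j 0)) ->
    (forall j, measurable_fun setT (fun w => u w j 0)) ->
    (forall w, V (u w)) ->
  measurable_fun setT (fun w => G (x w) (u w) w i 0).
Proof.
move=> mG mx mu Vu; have [mh Dh] := selection_measurable mx mu Vu.
have -> : (fun w => G (x w) (u w) w i 0) = (fun w =>
    G (usubmx (col_mx (x w) (u w))) (dsubmx (col_mx (x w) (u w))) w i 0).
  by apply/funext => w; rewrite col_mxKu col_mxKd.
apply: (@measurable_fun_caratheodory _ _ _ _ D
  (fun z w => G (usubmx z) (dsubmx z) w i 0) _ _ _ mh Dh).
- by move=> z Dz; exact: mG.
- move=> w z Dz eps eps0.
  have [r r0 rD] := jacobian_within_continuous (jac w Dz) eps0.
  by exists r => // y Dy yz; exact: rD.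
Qed.

Lemma coefficient_x_measurable (x : T -> 'cV[R]_n) (u : T -> 'cV[R]_m) i j :
    (forall x v, V v -> measurable_fun setT (fun w => G x v w i 0)) ->
    (forall j, measurable_fun setT (fun w => x w j 0)) ->
    (forall j, measurable_fun setT (fun w => u w j 0)) ->
    (forall w, V (u w)) ->
  measurable_fun setT (fun w => G_x (x w) (u w) w i j).
Proof.
move=> mG mx mu Vu; have [mh Dh] := selection_measurable mx mu Vu.
pose J z w :=
  row_mx (G_x (usubmx z) (dsubmx z) w) (G_u (usubmx z) (dsubmx z) w).
have -> : (fun w => G_x (x w) (u w) w i j) =
    (fun w => J (col_mx (x w) (u w)) w i (lshift m j)).
  by apply/funext => w; rewrite /J row_mxEl col_mxKu col_mxKd.
apply: (jacobian_measurable jac _ mh Dh).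
  by move=> z Dz; exact: mG.
move=> k w; rewrite /D/=.
rewrite (_ : delta_mx _ _ = col_mx (delta_mx j 0) 0); last first.
  apply/matrixP => a b; rewrite !mxE ord1; case: splitP => c ac.
    by rewrite !mxE -!val_eqE /= ac.
  rewrite !mxE -val_eqE/= ac; case: eqP => //= nc.
  by have := ltn_ord j; rewrite -nc ltnNge leq_addr.
by rewrite scale_col_mx scaler0 add_col_mx addr0 col_mxKd.
Qed.

(** A bound on the derivatives gives a Lipschitz bound because the domain, the
    product of the whole space with V, is convex. *)
Lemma coefficient_growth (L : R) x u x' u' w i :
    convex_set V -> V u -> V u' ->
    (forall x v, V v -> enorm (G_x x v w) + enorm (G_u x v w) <= L) ->
  `|G x u w i 0 - G x' u' w i 0| <=
    L * (\sum_j `|x j 0 - x' j 0| + \sum_j `|u j 0 - u' j 0|).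
Proof.
move=> Vconv Vu Vu' GL.
have := @mean_value_within _ _ _ D (fun z => G (usubmx z) (dsubmx z) w)
  (fun z => row_mx (G_x (usubmx z) (dsubmx z) w) (G_u (usubmx z) (dsubmx z) w))
  L (col_mx x u) (col_mx x' u') i.
rewrite !col_mxKu !col_mxKd big_split_ord/=.
have -> : \sum_(k < n)
      `|col_mx x u (lshift m k) 0 - col_mx x' u' (lshift m k) 0| =
    \sum_j `|x j 0 - x' j 0|.
  by apply: eq_bigr => k _; rewrite !col_mxEu.
have -> : \sum_(k < m)
      `|col_mx x u (rshift n k) 0 - col_mx x' u' (rshift n k) 0| =
    \sum_j `|u j 0 - u' j 0|.
  by apply: eq_bigr => k _; rewrite !col_mxEd.
apply.
- move=> t /andP[t0 t1]; rewrite /D/= linearD linearZ linearB/= !col_mxKd.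
  have := Vconv u u' (Itv01 t0 t1); rewrite !inE => /(_ Vu Vu').
  by congr V; rewrite /conv/= scalerBr scalerBl scale1r addrCA addrA addrAC.
- by move=> z Dz; exact: jac.
- move=> z j Dz; apply: le_trans (GL (usubmx z) _ Dz).
  case: (splitP j) => k jk.
    rewrite (_ : j = lshift m k) ?row_mxEl; last exact: val_inj.
    by rewrite (le_trans (ler_enorm_entry _ i k))// lerDl enorm_ge0.
  rewrite (_ : j = rshift n k) ?row_mxEr; last exact: val_inj.
  by rewrite (le_trans (ler_enorm_entry _ i k))// lerDr enorm_ge0.
Qed.

End coefficients.

(** * Square integrability and conditional expectation *)

Section square_integrable.
Context {R : realType} {disp : measure_display} {T : measurableType disp}.
Variable P : probability T R.
Implicit Types X Y : T -> R.

Definition square_integrable X :=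
  measurable_fun setT X /\ P.-integrable setT (EFin \o (fun w => X w ^+ 2)).

Lemma square_integrable_le X Y : measurable_fun setT X ->
  square_integrable Y -> (forall w, `|X w| <= `|Y w|) -> square_integrable X.
Proof.
move=> mX [mY iY] XY; split => //.
apply: (le_integrable _ _ _ iY) => //.
  by apply/measurable_EFinP; exact: measurable_funX.
by move=> w _ /=; rewrite lee_fin !normrX lerXn2r ?nnegrE.
Qed.

Lemma square_integrable_bound X (C : \bar R) : measurable_fun setT X ->
  (\int[P]_w (X w ^+ 2)%:E <= C)%E -> (C < +oo)%E -> square_integrable X.
Proof.
move=> mX XC Coo; split => //; apply/integrableP; split.
  by apply/measurable_EFinP; exact: measurable_funX.
apply: le_lt_trans Coo; apply: le_trans XC; rewrite le_eqVlt; apply/orP; left.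
by apply/eqP; apply: eq_integral => w _ /=; rewrite ger0_norm// sqr_ge0.
Qed.

Lemma square_integrableD X Y : square_integrable X -> square_integrable Y ->
  square_integrable (fun w => X w + Y w).
Proof.
move=> [mX iX] [mY iY]; split; first exact: measurable_funD.
have := integrableZ_EFin 2 (integrableD_EFin iX iY).
apply: (le_integrable measurableT).
  by apply/measurable_EFinP/measurable_funX; exact: measurable_funD.
move=> w _ /=; rewrite lee_fin (ger0_norm (sqr_ge0 _)) ger0_norm.
  by have := sqr_ge0 (X w - Y w); nra.
by rewrite mulr_ge0// addr_ge0// sqr_ge0.
Qed.

Lemma square_integrable_cst c : square_integrable (cst c).
Proof. by split => //; exact: (finite_measure_integrable_cst P (c ^+ 2)). Qed.

Lemma square_integrable_sum (I : Type) (r : seq I) (X : I -> T -> R) :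
  (forall i, square_integrable (X i)) ->
  square_integrable (fun w => \sum_(i <- r) X i w).
Proof.
move=> iX; elim: r => [|i r IH].
  by under eq_fun do rewrite big_nil; exact: square_integrable_cst.
by under eq_fun do rewrite big_cons; exact: square_integrableD.
Qed.

Lemma square_integrable_norm X : square_integrable X ->
  square_integrable (fun w => `|X w|).
Proof.
move=> iX; apply: square_integrable_le (iX) _ => [|w].
  by apply: measurableT_comp => //; exact: iX.1.
by rewrite normr_id.
Qed.

Lemma square_integrable_bounded_mul X Y (C : R) : measurable_fun setT X ->
  (forall w, `|X w| <= C) -> square_integrable Y ->
  square_integrable (fun w => X w * Y w).
Proof.
move=> mX XC [mY iY]; split; first exact: measurable_funM.
have := integrableZ_EFin (C ^+ 2) iY; apply: (le_integrable measurableT).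
  by apply/measurable_EFinP/measurable_funX; exact: measurable_funM.
move=> w _ /=; rewrite lee_fin -exprMn !normrX lerXn2r ?nnegrE// !normrM.
by rewrite ler_wpM2r// (le_trans (XC w))// ler_norm.
Qed.

Lemma square_integrableM X Y : square_integrable X -> square_integrable Y ->
  P.-integrable setT (EFin \o (fun w => X w * Y w)).
Proof.
move=> [mX iX] [mY iY]; have := integrableD_EFin iX iY.
apply: (le_integrable measurableT).
  by apply/measurable_EFinP; exact: measurable_funM.
move=> w _ /=; rewrite lee_fin (@ger0_norm _ (_ + _)) ?addr_ge0 ?sqr_ge0//.
rewrite ler_norml; apply/andP; split.
  by have := sqr_ge0 (X w + Y w); nra.
by have := sqr_ge0 (X w - Y w); nra.
Qed.

Lemma square_integrable_integrable X : square_integrable X ->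
  P.-integrable setT (EFin \o X).
Proof.
move=> /square_integrableM/(_ (square_integrable_cst 1)).
by congr (P.-integrable _ _); apply/funext => w /=; rewrite mulr1.
Qed.

End square_integrable.

Section conditional_expectation.
Context {R : realType} {disp : measure_display} {Omega : measurableType disp}.
Context {d : nat}.
Variables (W : nat -> Omega -> 'cV[R]_d) (P : probability Omega R) (k : nat).
Hypothesis Fk_sub : Fk W k `<=` measurable.
Implicit Types X Y : Omega -> R.

Let T' : measurableType (Fgen W k).-sigma := g_sigma_algebraType (Fgen W k).

Let idT : Omega -> T' := id.

Let m_idT : measurable_fun setT idT.
Proof. by move=> _ B mB; rewrite setTI; exact: Fk_sub. Qed.

(** The version Y is a Radon-Nikodym derivative with respect to P, on the
    measurable space (Omega, F_k), of the charge that maps B to E[X; B]. *)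
Lemma cond_exp_exists X : P.-integrable setT (EFin \o X) ->
  exists Y, is_cond_exp W P k X Y.
Proof.
move=> iX.
pose nu := pushforward (induced_charge iX) idT.
(* The charge structure on a pushforward takes the measurability proof as an
   argument. *)
pose nu_ : {charge set T' -> \bar R} := nu.
pose nu' := nu_ m_idT.
pose mu : probability T' R := distribution P (mfun_Sub (mem_set m_idT)).
have numu : nu `<< mu.
  apply/null_content_dominatesP => A mA muA; apply: null_set_integral => //.
    exact: Fk_sub.
  by apply: measurable_funTS; exact: measurable_int iX.
pose g := Radon_Nikodym nu' mu.
have g_fin w : g w \is a fin_num by exact: Radon_Nikodym_fin_num.
have g_int : mu.-integrable setT g by exact: Radon_Nikodym_integrable.
pose Y : T' -> R := fine \o g.
have gE : g = EFin \o Y by apply/funext => w; rewrite /Y/= fineK.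
have mg : measurable_fun setT g := measurable_int mu g_int.
have mY : Fk_measurable W k Y by exact: measurableT_comp mg.
have YP : P.-integrable setT (EFin \o (Y \o idT)).
  apply/integrableP; split.
    by apply/measurable_EFinP; exact: Fk_measurable_measurable Fk_sub _.
  have := g_int => /integrableP[_]; rewrite ge0_integral_distribution//.
    by rewrite gE.
  exact: (measurableT_comp (@abse_measurable R setT) mg).
exists (Y \o idT); split => // B FB.
transitivity (\int[mu]_(x in B) g x)%E; last first.
  exact/esym/(Radon_Nikodym_integral (nu := nu') (mu := mu) numu FB).
rewrite gE.
rewrite (integral_pushforward m_idT)//.
- by apply/measurable_EFinP; exact: mY.
- apply: integrableS YP => //; exact: Fk_sub.
Qed.

(** The set where the inequality fails belongs to F_k, so the hypothesis applies
    to it and shows that it is null. *)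
Lemma le_ae_of_sets Y Y' : Fk_measurable W k Y -> Fk_measurable W k Y' ->
    P.-integrable setT (EFin \o Y) -> P.-integrable setT (EFin \o Y') ->
    (forall B, Fk W k B ->
      \int[P]_(w in B) Y w <= \int[P]_(w in B) Y' w) ->
  {ae P, forall w, Y w <= Y' w}.
Proof.
move=> mY mY' iY iY' YY'.
pose B := [set w | Y' w < Y w].
have FB : Fk W k B.
  have := measurable_funB (T := T') mY mY' measurableT
    (measurable_itv `]0, +oo[).
  rewrite setTI; congr (Fk W k _); apply/seteqP.
  by split => w; rewrite /= in_itv/= andbT subr_gt0.
have mB := Fk_sub FB.
have iYB : P.-integrable B (EFin \o Y) by exact: integrableS iY.
have iYB' : P.-integrable B (EFin \o Y') by exact: integrableS iY'.
have mD : measurable_fun setT (fun w => (Y w - Y' w)%:E).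
  apply/measurable_EFinP; apply: measurable_funB;
    exact: Fk_measurable_measurable Fk_sub _.
have D0 : (\int[P]_(w in B) `|(Y w - Y' w)%:E|)%E = 0%E.
  apply/eqP; rewrite eq_le integral_ge0// andbT.
  rewrite (_ : integral _ _ _ = \int[P]_(w in B) (Y w - Y' w)%:E)%E; last first.
    apply: eq_integral => w; rewrite inE => Bw.
    by rewrite gee0_abs// lee_fin subr_ge0 ltW.
  under eq_integral do rewrite EFinB.
  rewrite integralB//.
  have := YY' _ FB; rewrite -subr_le0 -lee_fin EFinB /Rintegral !fineK//;
    exact: integrable_fin_num.
have [+ _] := ae_eq_integral_abs P mB (measurable_funTS mD).
move=> /(_ D0); apply: filterS => w BD; rewrite leNgt; apply/negP => Bw.
by have := BD Bw; case=> /eqP; rewrite subr_eq0 gt_eqF.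
Qed.

Lemma cond_exp_unique X X' Y Y' : {ae P, forall w, X w = X' w} ->
  is_cond_exp W P k X Y -> is_cond_exp W P k X' Y' ->
  {ae P, forall w, Y w = Y' w}.
Proof.
move=> XX' [iX iY mY YX] [iX' iY' mY' YX'].
have E B : Fk W k B -> \int[P]_(w in B) Y w = \int[P]_(w in B) Y' w.
  move=> FB; have mB := Fk_sub FB; rewrite /Rintegral YX// YX'//; congr fine.
  apply: ae_eq_integral => //.
  - by apply: measurable_funTS; exact: measurable_int iX.
  - by apply: measurable_funTS; exact: measurable_int iX'.
  - by apply: filterS XX' => w /= ->.
have le1 : {ae P, forall w, Y w <= Y' w}.
  by apply: le_ae_of_sets => // B /E ->.
have le2 : {ae P, forall w, Y' w <= Y w}.
  by apply: le_ae_of_sets => // B /E ->.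
by apply: filterS2 le1 le2 => w ? ?; apply/eqP; rewrite eq_le; apply/andP.
Qed.

(** A conditional Cauchy-Schwarz inequality. For every t, 2 t X V is at most
    c X ^ 2 + t ^ 2 V ^ 2 / c, and E[V ^ 2; B] <= c P(B) for B in F_k; hence
    2 t Y <= c E[X ^ 2 | F_k] + t ^ 2 almost surely, for all rational
    t at once, and letting t tend to Y gives Y ^ 2 <= c E[X ^ 2 | F_k]. *)
Lemma cond_exp_square_integrable X V Y (c : R) : 0 < c ->
    square_integrable P X -> square_integrable P V ->
    (forall B, Fk W k B ->
       \int[P]_(w in B) (V w ^+ 2) <= \int[P]_(w in B) c) ->
    is_cond_exp W P k (fun w => X w * V w) Y ->
  square_integrable P Y.
Proof.
move=> c0 iX iV Vc [iXV iY mY YE].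
have [Z [iX2 iZ mZ ZE]] := cond_exp_exists iX.2.
have YZt (t : R) : {ae P, forall w, 2 * t * Y w <= c * Z w + t ^+ 2}.
  apply: le_ae_of_sets.
  - apply: measurable_funM => //.
  - apply: measurable_funD => //; apply: measurable_funM => //.
  - exact: integrableZ_EFin.
  - apply: integrableD_EFin; first exact: integrableZ_EFin.
    exact: finite_measure_integrable_cst.
  move=> B FB; have mB := Fk_sub FB.
  have sub f : P.-integrable setT (EFin \o f) -> P.-integrable B (EFin \o f).
    exact: integrableS.
  have icst (r : R) : P.-integrable B (EFin \o cst r).
    exact: finite_measure_integrable_cst.
  rewrite RintegralZl ?sub//.
  rewrite RintegralD//; last 2 first.
  - by apply: sub; exact: integrableZ_EFin.
  - exact: icst.

  rewrite RintegralZl ?sub//.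
  have -> : \int[P]_(w in B) Y w = \int[P]_(w in B) (X w * V w).
    by rewrite /Rintegral YE.
  have -> : \int[P]_(w in B) Z w = \int[P]_(w in B) (X w ^+ 2).
    by rewrite /Rintegral ZE.
  rewrite -!RintegralZl ?sub//.
  apply: (@le_trans _ _
      (\int[P]_(w in B) (c * X w ^+ 2 + t ^+ 2 / c * V w ^+ 2))).
    apply: le_Rintegral => //.
    - by apply: sub; exact: integrableZ_EFin.
    - apply: sub; apply: integrableD_EFin; apply: integrableZ_EFin;
        [exact: iX.2|exact: iV.2].
    move=> w _; have := sqr_ge0 (c * X w - t * V w) => sq.
    rewrite -(ler_pM2l c0) (_ : c * (c * X w ^+ 2 + t ^+ 2 / c * V w ^+ 2) =
      c ^+ 2 * X w ^+ 2 + t ^+ 2 * V w ^+ 2).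
      by move: sq; nra.
    by field; rewrite gt_eqF.
  rewrite RintegralD//; last 2 first.
  - by apply: sub; apply: integrableZ_EFin; exact: iX.2.
  - by apply: sub; apply: integrableZ_EFin; exact: iV.2.
  rewrite lerD2l RintegralZl//; last by apply: sub; exact: iV.2.
  have t2c : 0 <= t ^+ 2 / c by rewrite divr_ge0 ?sqr_ge0// ltW.
  apply: le_trans (ler_wpM2l t2c (Vc _ FB)) _.
  by rewrite !Rintegral_cst// mulrA divfK ?gt_eqF.
have YZ : {ae P, forall w, Y w ^+ 2 <= c * Z w}.
  have : {ae P, forall w, forall t : rat,
      2 * ratr t * Y w <= c * Z w + (ratr t) ^+ 2}.
    have : {ae P, forall w, forall n : nat,
        2 * ratr (odflt 0 (unpickle n)) * Y w <=
          c * Z w + ratr (odflt 0 (unpickle n)) ^+ 2}.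
      by apply: ae_foralln => n; exact: YZt.
    by apply: filterS => w H t; have := H (pickle t); rewrite pickleK.
  apply: filterS => w H; apply/ler_addgt0Pr => e e0.
  (* Y^2 = 2 q Y - q^2 + (Y - q)^2, and (Y - q)^2 <= r^2 <= e. *)
  pose r := Num.min 1 e.
  have r0 : 0 < r by rewrite lt_min ltr01.
  have r1 : r <= 1 by rewrite ge_min lexx.
  have re : r <= e by rewrite ge_min lexx orbT.
  have /rat_in_itvoo[s] : Y w < Y w + r by rewrite ltrDl.
  rewrite in_itv/= => /andP[s1 s2]; have := H s; set q : R := ratr s in s1 s2 *.
  by nra.
have mY' := Fk_measurable_measurable Fk_sub mY.
have mZ' := Fk_measurable_measurable Fk_sub mZ.
apply: (@square_integrable_bound _ _ _ _ _ (\int[P]_w `|(c * Z w)%:E|)%E) => //.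
  apply: ae_ge0_le_integral => //.
  - by move=> w _; rewrite lee_fin sqr_ge0.
  - by apply/measurable_EFinP; exact: measurable_funX.
  - apply/measurableT_comp => //; apply/measurable_EFinP.
    by apply: measurable_funM.
  - apply: filterS YZ => w YZw _; rewrite lee_fin.
    by rewrite (le_trans YZw)// ler_norm.
by have /integrableP[] := integrableZ_EFin c iZ.
Qed.

End conditional_expectation.

(** * Second moments under a dominated measure *)

Section dominated_process.
Context {R : realType} {disp : measure_display} {Omega : measurableType disp}.
Context {Theta : Type} {d n m N : nat}.
Hypothesis hTheta : inhabited Theta.
Variable F : Theta -> probability (borelM R d 1) R.
Variable W : nat -> Omega -> 'cV[R]_d.
Hypothesis hFN : @measurable _ Omega = Fk W N.
Hypothesis W_Lc : assumption_W N F W.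
Hypothesis A3 : assumption_A3 N F W.
Variable P : probability Omega R.
Hypothesis PP : calP N F W P.

Local Notation past_fun := (past_fun (N := N) W P).

Lemma Lc2_square_integrable k X : (k <= N)%N -> Lc N F W 2 k X ->
  square_integrable P X.
Proof.
move=> kN LX; have [C XC] := Lc2_moment hFN kN LX.
by apply: square_integrable_bound (XC _ PP) _; [exact: LX.1|rewrite ltry].
Qed.

(** Without a bounded conditional second moment of the noise, the product of two
    square integrable variables would only be integrable. *)
Lemma noise_mul_square_integrable k i X : (k < N)%N -> past_fun k X ->
  square_integrable P X -> square_integrable P (fun w => X w * W k.+1 w i 0).
Proof.
move=> kN pX iX.
have [C C0 XC] := past_second_moment hTheta hFN W_Lc A3 PP i kN.
apply: (@square_integrable_bound _ _ _ _ _ (\int[P]_w (X w ^+ 2 * C)%:E)).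
- apply: measurable_funM; first exact: iX.1.
  exact: (W_measurable W_Lc i kN).
- under eq_integral do rewrite exprMn; apply: XC => [|w]; last exact: sqr_ge0.
  exact: measurable_funX.
- have := integrableZ_EFin C iX.2 => /integrableP[_].
  apply: le_lt_trans; rewrite le_eqVlt; apply/orP; left; apply/eqP.
  apply: eq_integral => w _ /=; rewrite mulrC ger0_norm//.
  by rewrite mulr_ge0// sqr_ge0.
Qed.

Section coefficient_along.
Variables (k q : nat) (V : set 'cV[R]_m).
Variables (G : 'cV[R]_n -> 'cV[R]_m -> Omega -> 'cV[R]_q).
Variables (G_x : 'cV[R]_n -> 'cV[R]_m -> Omega -> 'M[R]_(q, n)).
Variables (G_u : 'cV[R]_n -> 'cV[R]_m -> Omega -> 'M[R]_(q, m)).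
Hypothesis kN : (k < N)%N.
Hypothesis Vconv : convex_set V.
Hypothesis G_diff : forall w, jacobian_xu V (fun x u => G x u w)
  (fun x u => G_x x u w) (fun x u => G_u x u w).
Hypothesis G_Lc : forall x v, V v -> Lc_vec N F W 2 k (G x v).
Variable L : R.
Hypothesis G_L : forall x v w, V v ->
  enorm (G_x x v w) + enorm (G_u x v w) <= L.
Variables (x : Omega -> 'cV[R]_n) (u : Omega -> 'cV[R]_m).
Hypothesis x_past : forall i, past_fun k (fun w => x w i 0).
Hypothesis u_past : forall i, past_fun k (fun w => u w i 0).
Hypothesis x_sqr : forall i, square_integrable P (fun w => x w i 0).
Hypothesis u_sqr : forall i, square_integrable P (fun w => u w i 0).
Hypothesis uV : forall w, V (u w).

Lemma coefficient_past i : past_fun k (fun w => G (x w) (u w) w i 0).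
Proof.
apply: (@coefficient_measurable R _ (g_sigma_algebraType (past (N := N) W P k))
  n m q V G G_x G_u) => //.
move=> y v Vv; apply: (past_fun_Lc W_Lc PP (ltnW kN)).
exact: G_Lc.
Qed.

Lemma coefficient_square_integrable i :
  square_integrable P (fun w => G (x w) (u w) w i 0).
Proof.
pose u0 := u point.
have L0 : 0 <= L.
  apply: le_trans (G_L 0 point (uV point)); by rewrite addr_ge0 ?enorm_ge0.
have iu0 j : square_integrable P (fun w => `|u w j 0 - u0 j 0|).
  apply: square_integrable_norm; apply: square_integrableD => //.
  exact: square_integrable_cst.
have iS : square_integrable P (fun w =>
    \sum_j `|x w j 0| + \sum_j `|u w j 0 - u0 j 0|).
  apply: square_integrableD; apply: square_integrable_sum => j //.
  exact: square_integrable_norm.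
have iLS : square_integrable P (fun w =>
    cst L w * (\sum_j `|x w j 0| + \sum_j `|u w j 0 - u0 j 0|)).
  apply: (square_integrable_bounded_mul (C := L)) => // w.
  by rewrite ger0_norm.
have iG0 := square_integrable_norm
  (Lc2_square_integrable (ltnW kN) (G_Lc 0 (uV point) i)).
apply: square_integrable_le (square_integrableD iG0 iLS) _.
  by apply: (past_fun_measurable W_Lc); exact: coefficient_past.
move=> w; rewrite [leRHS]ger0_norm; last first.
  by rewrite addr_ge0// mulr_ge0// addr_ge0// sumr_ge0.
rewrite -(subrKC (G 0 u0 w i 0) (G (x w) (u w) w i 0)).
rewrite (le_trans (ler_normD _ _))// lerD2l.
have := coefficient_growth G_diff (x w) 0 i Vconv (uV w) (uV point)
  (fun y v => @G_L y v w).
by under eq_bigr do rewrite mxE subr0.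
Qed.

End coefficient_along.

Lemma cond_exp_noise_square_integrable k i X Y : (k < N)%N ->
  square_integrable P X -> is_cond_exp W P k (fun w => X w * W k.+1 w i 0) Y ->
  square_integrable P Y.
Proof.
move=> kN iX.
have Fksub := Fk_sub_measurable hFN (ltnW kN).
have iV : square_integrable P (fun w => W k.+1 w i 0).
  exact: Lc2_square_integrable (W_Lc (k := k.+1) kN i).
have [C C0 XC] := past_second_moment hTheta hFN W_Lc A3 PP i kN.
apply: (@cond_exp_square_integrable _ _ _ _ _ _ _ Fksub _ _ _ (C + 1)) => //.
  by rewrite ltr_wpDl.
move=> B FB; have mB := Fksub _ FB.
have icst (r : R) : P.-integrable B (EFin \o cst r).
  exact: finite_measure_integrable_cst.
apply: (@le_trans _ _ (\int[P]_(w in B) C)); last first.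
  by apply: (le_Rintegral mB (icst C) (icst (C + 1))) => w _; rewrite /= lerDl.
rewrite -lee_fin /Rintegral !fineK; last 2 first.
- by apply: integrable_fin_num => //; exact: icst.
- by apply: integrable_fin_num => //; apply: integrableS iV.2.
have patch (f : Omega -> R) :
    (\int[P]_(w in B) (f w)%:E = \int[P]_w (\1_B w * f w)%:E)%E.
  rewrite -[in LHS](setTI B) integral_mkcondr; apply: eq_integral => w _.
  by rewrite epatch_indic muleC.
rewrite !patch; apply: XC => [|w]; last by rewrite indicE.
have pB := Fk_past W_Lc P (ltnW kN) FB.
rewrite -(measurable_pastE W_Lc P k) in pB.
exact: measurable_indic pB.
Qed.

Lemma cond_exp_keeps_square_integrable k X Y : (k <= N)%N ->
  square_integrable P X -> is_cond_exp W P k X Y -> square_integrable P Y.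
Proof.
move=> kN iX XY; have Fksub := Fk_sub_measurable hFN kN.
apply: (@cond_exp_square_integrable _ _ _ _ _ _ _ Fksub X (cst 1) _ 1) => //.
- exact: square_integrable_cst.
- by move=> B FB; rewrite /cst expr1n.
- by move: XY; congr (is_cond_exp _ _ _ _ _); apply/funext => w; rewrite mulr1.
Qed.

End dominated_process.

Lemma square_integrable_enorm (R : realType) disp (T : measurableType disp)
    (P : probability T R) p q (Y : T -> 'M[R]_(p, q)) :
  (forall i j, square_integrable P (fun w => Y w i j)) ->
  square_integrable P (fun w => enorm (Y w)).
Proof.
move=> iY.
have iS : square_integrable P (fun w => \sum_i \sum_j `|Y w i j|).
  apply: square_integrable_sum => i; apply: square_integrable_sum => j.
  exact: square_integrable_norm.
apply: square_integrable_le iS _.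
  apply: measurableT_comp.
    by apply: continuous_measurable_fun; exact: sqrt_continuous.
  apply: measurable_sum => i; apply: measurable_sum => j.
  by apply: measurable_funX; exact: (iY i j).1.
move=> w; rewrite ger0_norm ?enorm_ge0//.
by apply: le_trans (ler_enorm_sum _) _; exact: ler_norm.
Qed.

Section cond_exp_mx.
Context {R : realType} {disp : measure_display} {Omega : measurableType disp}.
Context {d : nat}.
Variables (W : nat -> Omega -> 'cV[R]_d) (P : probability Omega R) (k : nat).
Hypothesis Fk_sub : Fk W k `<=` measurable.
Context {p q : nat}.
Implicit Types Y Z : Omega -> 'M[R]_(p, q).

Lemma cond_exp_mx_exists Z :
  (forall i j, P.-integrable setT (EFin \o (fun w => Z w i j))) ->
  exists Y, is_cond_exp_mx W P k Z Y.
Proof.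
move=> iZ; exists (fun w => \matrix_(i, j)
  sval (cid (cond_exp_exists Fk_sub (iZ i j))) w) => i j.
have := svalP (cid (cond_exp_exists Fk_sub (iZ i j))).
by congr (is_cond_exp _ _ _ _ _); apply/funext => w; rewrite mxE.
Qed.

Lemma cond_exp_mx_unique Z Z' Y Y' : {ae P, forall w, Z w = Z' w} ->
  is_cond_exp_mx W P k Z Y -> is_cond_exp_mx W P k Z' Y' ->
  {ae P, forall w, Y w = Y' w}.
Proof.
move=> ZZ' ZY ZY'.
have H (ij : 'I_p * 'I_q) : {ae P, forall w, Y w ij.1 ij.2 = Y' w ij.1 ij.2}.
  apply: cond_exp_unique (ZY _ _) (ZY' _ _) => //.
  by apply: filterS ZZ' => w ->.
have : {ae P, forall w, forall ij : 'I_p * 'I_q,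
    Y w ij.1 ij.2 = Y' w ij.1 ij.2} by exact: filter_forall.
apply: filterS => w YY'.
by apply/matrixP => i j; exact: (YY' (i, j)).
Qed.

End cond_exp_mx.

(** The invariant S is what makes each backward step possible; here it will be
    square integrability. *)
Lemma backward_recursion (T : Type) (start : T -> Prop) (S : nat -> T -> Prop)
    (step : nat -> T -> T -> Prop) (N : nat) :
    (exists2 t, start t & S N t) ->
    (forall k t, (k < N)%N -> S k.+1 t -> exists2 s, step k t s & S k s) ->
  exists f : nat -> T, [/\ start (f N), forall k, (k <= N)%N -> S k (f k) &
    forall k, (k < N)%N -> step k (f k.+1) (f k)].
Proof.
elim: N S step => [S step [t st St] _|N IH S step st Sstep].
  by exists (fun=> t); split => // -[].
have [f [f_start fS fstep]] :=
  IH (S \o succn) (step \o succn) st (fun k t kN => Sstep k.+1 t kN).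
have [s s_step Ss] := Sstep 0%N (f 0%N) isT (fS 0%N isT).
by exists (fun k => if k is k'.+1 then f k' else s); split => // -[].
Qed.

(** * State process and adjoint equation *)

Section adjoint.
Context {R : realType} {disp : measure_display} {Omega : measurableType disp}.
Context {Theta : Type} {d n m N : nat}.
Hypothesis hd : (0 < d)%N.
Hypothesis hN : (0 < N)%N.
Hypothesis hTheta : inhabited Theta.
Variable F : Theta -> probability (borelM R d 1) R.
Variable W : nat -> Omega -> 'cV[R]_d.
Hypothesis hFN : @measurable _ Omega = Fk W N.
Hypothesis W_Lc : assumption_W N F W.
Hypothesis A3 : assumption_A3 N F W.
Variable pb : problem R Omega d n m.
Hypothesis hU : convex_controls N pb.
Hypothesis hdiff : differentiable_coefficients N pb.
Hypothesis H1 : assumption_H1 N F W pb.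
Hypothesis H2 : assumption_H2 N pb.
Variable ustar : nat -> Omega -> 'cV[R]_m.
Hypothesis u_adm : admissible N F W pb ustar.
Variable P : probability Omega R.
Hypothesis PP : calP N F W P.

Local Notation X := (state W pb ustar).

Let uU k w : (k < N)%N -> U pb k (ustar k w).
Proof. by move=> kN; exact: (u_adm kN).1. Qed.

Let u_past k i : (k < N)%N -> past_fun (N := N) W P k (fun w => ustar k w i 0).
Proof.
move=> kN; apply: (past_fun_Lc W_Lc PP (ltnW kN)).
exact: (u_adm kN).2.
Qed.

Let u_sqr k i : (k < N)%N -> square_integrable P (fun w => ustar k w i 0).
Proof.
move=> kN; apply: (Lc2_square_integrable hFN PP (ltnW kN)).
exact: (u_adm kN).2.
Qed.

Let derivative_bound : exists2 L : R, 0 < L &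
  forall k x u w, (k < N)%N -> U pb k u ->
    [/\ enorm (b_x pb k x u w) + enorm (b_u pb k x u w) <= L,
        forall l,
          enorm (sigma_x pb l k x u w) + enorm (sigma_u pb l k x u w) <= L,
        enorm (f_x pb k x u w) <= L * (1 + enorm x + enorm u) &
        enorm (varphi_x pb x w) <= L * (1 + enorm x + enorm u)].
Proof.
have [L L0 HL] := H2; exists L => // k x u w kN Uu.
have [bs fv] := HL k x u w kN Uu.
split.
- (* The bound on the derivatives of b is stated jointly with those of sigma^l
     for each l, so it takes an index l to extract it. *)
  apply: le_trans (bs (Ordinal hd)); rewrite -addrA lerDl.
  by rewrite addr_ge0 ?enorm_ge0.
- move=> l; apply: le_trans (bs l).
  by rewrite -[leRHS]addrA lerDr addr_ge0 ?enorm_ge0.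
- by apply: le_trans fv; rewrite -addrA lerDl addr_ge0 ?enorm_ge0.
- by apply: le_trans fv; rewrite lerDr addr_ge0 ?enorm_ge0.
Qed.

(** Forward induction: by linear growth the coefficients are square integrable
    along the state and the control, and they belong to the past, so multiplying
    them by the next noise keeps them square integrable. *)
Lemma state_square_integrable k i : (k <= N)%N ->
  past_fun (N := N) W P k (fun w => X k w i 0) /\
  square_integrable P (fun w => X k w i 0).
Proof.
elim: k i => [i _|k IH i kN].
  split; last exact: square_integrable_cst.
  exact: measurable_cst.
have [L L0 HL] := derivative_bound.
have Xpast j := (IH j (ltnW kN)).1; have Xsqr j := (IH j (ltnW kN)).2.
have [_ Uconv] := hU kN.
have bL x v w : U pb k v ->
    enorm (b_x pb k x v w) + enorm (b_u pb k x v w) <= L.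
  by move=> Uv; have [] := HL k x v w kN Uv.
have sL l x v w : U pb k v ->
    enorm (sigma_x pb l k x v w) + enorm (sigma_u pb l k x v w) <= L.
  by move=> Uv; have [_ + _ _] := HL k x v w kN Uv; exact.
have bdiff w := let: And3 h _ _ := hdiff.1 k w kN in h.
have sdiff l w := let: And3 _ h _ := hdiff.1 k w kN in h l.
have bLc x v (Uv : U pb k v) := let: And3 h _ _ := H1.1 k x v kN Uv in h.
have sLc l x v (Uv : U pb k v) := let: And3 _ h _ := H1.1 k x v kN Uv in h l.
have u_past' j := u_past j kN; have u_sqr' j := u_sqr j kN.
have uU' w := uU w kN.
have XE : (fun w => X k.+1 w i 0) = (fun w =>
    b pb k (X k w) (ustar k w) w i 0 +
    \sum_(l < d) sigma pb l k (X k w) (ustar k w) w i 0 * W k.+1 w l 0).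
  apply/funext => w /=; rewrite mxE summxE; congr (_ + _).
  by apply: eq_bigr => l _; rewrite mxE mulrC.
rewrite XE; split.
  apply: measurable_funD.
    apply: (past_funS W_Lc (leqnSn k)).
    exact: (coefficient_past W_Lc PP kN bdiff bLc Xpast u_past' uU').
  apply: measurable_sum => l; apply: measurable_funM.
    apply: (past_funS W_Lc (leqnSn k)).
    exact: (coefficient_past W_Lc PP kN (sdiff l) (sLc l) Xpast u_past' uU').
  exact: (past_fun_W W_Lc PP l kN).
apply: square_integrableD.
  exact: (coefficient_square_integrable hFN W_Lc PP kN Uconv bdiff bLc bL
    Xpast u_past' Xsqr u_sqr' uU').
apply: square_integrable_sum => l.
apply: (noise_mul_square_integrable hTheta hFN W_Lc A3 PP l kN).
  exact: (coefficient_past W_Lc PP kN (sdiff l) (sLc l) Xpast u_past' uU').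
exact: (coefficient_square_integrable hFN W_Lc PP kN Uconv (sdiff l) (sLc l)
  (sL l) Xpast u_past' Xsqr u_sqr' uU').
Qed.

Let X_measurable k i : (k <= N)%N -> measurable_fun setT (fun w => X k w i 0).
Proof. by move=> kN; exact: (state_square_integrable i kN).2.1. Qed.

Let growth_square_integrable (L : R) k l : 0 < L -> (k <= N)%N -> (l < N)%N ->
  square_integrable P
    (fun w => cst L w * (1 + enorm (X k w) + enorm (ustar l w))).
Proof.
move=> L0 kN lN; apply: (square_integrable_bounded_mul (C := L)) => //.
  by move=> w; rewrite ger0_norm// ltW.
apply: square_integrableD; first apply: square_integrableD.
- exact: square_integrable_cst.
- apply: square_integrable_enorm => i j; rewrite ord1.
  by have [] := state_square_integrable i kN.
- by apply: square_integrable_enorm => i j; rewrite ord1; exact: u_sqr.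
Qed.

Let growth_ge0 (L : R) (x : 'cV[R]_n) (u : 'cV[R]_m) : 0 < L ->
  0 <= L * (1 + enorm x + enorm u).
Proof. by move=> L0; rewrite mulr_ge0 ?(ltW L0)// !addr_ge0 ?enorm_ge0. Qed.

Let terminal_gradient_square_integrable i :
  square_integrable P (fun w => varphi_x pb (X N w) w 0 i).
Proof.
have [L L0 HL] := derivative_bound.
have NN : (N.-1 < N)%N by rewrite prednK.
apply: square_integrable_le (growth_square_integrable L0 (leqnn N) NN) _.
  apply: (@jacobian_measurable _ _ _ _ _ setT
      (fun x w => (varphi pb x w)%:M) (varphi_x pb) (X N) 0 i) => //.
  - by move=> w z _; exact: hdiff.2.
  - move=> z _; under eq_fun do rewrite mxE eqxx mulr1n.
    exact: (H1.2 z).1.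
  - by move=> l; exact: X_measurable.
move=> w; rewrite [leRHS]ger0_norm ?growth_ge0//.
apply: le_trans (ler_enorm_entry _ _ _) _.
by have [] := HL N.-1 (X N w) (ustar N.-1 w) w NN (uU w NN).
Qed.

Let running_gradient_square_integrable k i : (k < N)%N ->
  square_integrable P (fun w => at_star W pb ustar (f_x pb) k w 0 i).
Proof.
move=> kN; have [L L0 HL] := derivative_bound.
apply: square_integrable_le (growth_square_integrable L0 (ltnW kN) kN) _.
  apply: (@coefficient_x_measurable _ _ _ n m 1 (U pb k)
      (fun x u w => (f pb k x u w)%:M) (f_x pb k) (f_u pb k)).
  - by move=> w; have [] := hdiff.1 k w kN.
  - move=> x v Uv; under eq_fun do rewrite mxE eqxx mulr1n.
    by have [_ _ []] := H1.1 k x v kN Uv.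
  - by move=> j; apply: X_measurable; exact: ltnW.
  - by move=> j; exact: (u_sqr j kN).1.
  - by move=> w; exact: uU.
move=> w; rewrite [leRHS]ger0_norm ?growth_ge0//.
apply: le_trans (ler_enorm_entry _ _ _) _.
by have [] := HL k (X k w) (ustar k w) w kN (uU w kN).
Qed.

Let jacobian_bounded k i j : (k < N)%N -> exists C : R,
  (measurable_fun setT (fun w => at_star W pb ustar (b_x pb) k w i j) /\
   forall w, `|at_star W pb ustar (b_x pb) k w i j| <= C) /\
  forall l,
  (measurable_fun setT (fun w => at_star W pb ustar (sigma_x pb l) k w i j) /\
   forall w, `|at_star W pb ustar (sigma_x pb l) k w i j| <= C).
Proof.
move=> kN; have [L L0 HL] := derivative_bound.
have Xm a : measurable_fun setT (fun w => X k w a 0).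
  by apply: X_measurable; exact: ltnW.
have um a : measurable_fun setT (fun w => ustar k w a 0) := (u_sqr a kN).1.
exists L; split => [|l]; split.
- apply: (@coefficient_x_measurable _ _ _ n m n (U pb k) (b pb k)
    (b_x pb k) (b_u pb k)) => //.
  + by move=> w; have [] := hdiff.1 k w kN.
  + by move=> x v Uv; have [bLc _ _] := H1.1 k x v kN Uv; exact: (bLc i).1.
  + by move=> w; exact: uU.
- move=> w; apply: le_trans (ler_enorm_entry _ _ _) _.
  have [bL _ _ _] := HL k (X k w) (ustar k w) w kN (uU w kN).
  by apply: le_trans bL; rewrite lerDl enorm_ge0.
- apply: (@coefficient_x_measurable _ _ _ n m n (U pb k) (sigma pb l k)
    (sigma_x pb l k) (sigma_u pb l k)) => //.
  + by move=> w; have [_ + _] := hdiff.1 k w kN; exact.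
  + by move=> x v Uv; have [_ sLc _] := H1.1 k x v kN Uv; exact: (sLc l i).1.
  + by move=> w; exact: uU.
- move=> w; apply: le_trans (ler_enorm_entry _ _ _) _.
  have [_ sL _ _] := HL k (X k w) (ustar k w) w kN (uU w kN).
  by apply: le_trans (sL l); rewrite lerDl enorm_ge0.
Qed.

Local Notation adjoint_pair :=
  ((Omega -> 'cV[R]_n) * (Omega -> 'M[R]_(n, d)))%type.

Let pair_sqr (pq : adjoint_pair) :=
  (forall i, square_integrable P (fun w => pq.1 w i 0)) /\
  (forall i l, square_integrable P (fun w => pq.2 w i l)).

Let rhs k (pq : adjoint_pair) : Omega -> 'cV[R]_n :=
  adjoint_rhs W pb ustar (fun=> pq.1) (fun=> pq.2) k.

Let adjoint_step k (zeta : Omega -> 'cV[R]_n) (pq : adjoint_pair) :=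
  is_cond_exp_mx W P k zeta pq.1 /\
  is_cond_exp_mx W P k (fun w => zeta w *m (W k.+1 w)^T) pq.2.

Let rhs_sqr k pq i : (k < N)%N -> pair_sqr pq ->
  square_integrable P (fun w => rhs k pq w i 0).
Proof.
move=> kN [ip iq]; rewrite /rhs /adjoint_rhs.
have -> : (fun w => ((at_star W pb ustar (b_x pb) k w)^T *m pq.1 w +
    \sum_(l < d) (at_star W pb ustar (sigma_x pb l) k w)^T *m col l (pq.2 w) +
    (at_star W pb ustar (f_x pb) k w)^T) i 0) =
  (fun w => \sum_j at_star W pb ustar (b_x pb) k w j i * pq.1 w j 0 +
    \sum_(l < d) \sum_j at_star W pb ustar (sigma_x pb l) k w j i * pq.2 w j l +
    at_star W pb ustar (f_x pb) k w 0 i).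
  apply/funext => w; rewrite !mxE summxE; congr (_ + _ + _).
    by apply: eq_bigr => j _; rewrite mxE.
  apply: eq_bigr => l _; rewrite mxE; apply: eq_bigr => j _.
  by rewrite !mxE.
apply: square_integrableD; first apply: square_integrableD.
- apply: square_integrable_sum => j.
  have [C [[mb bC] _]] := jacobian_bounded j i kN.
  exact: square_integrable_bounded_mul bC _.
- apply: square_integrable_sum => l; apply: square_integrable_sum => j.
  have [C [_ /(_ l)[ms sC]]] := jacobian_bounded j i kN.
  exact: square_integrable_bounded_mul sC _.
- exact: running_gradient_square_integrable.
Qed.

Let mul_noiseE k (zeta : Omega -> 'cV[R]_n) i l :
  (fun w => (zeta w *m (W k.+1 w)^T) i l) =
  (fun w => zeta w i 0 * W k.+1 w l 0).
Proof. by apply/funext => w; rewrite mxE big_ord1 mxE. Qed.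

Let adjoint_step_exists k (zeta : Omega -> 'cV[R]_n) : (k < N)%N ->
    (forall i, square_integrable P (fun w => zeta w i 0)) ->
  exists2 pq, adjoint_step k zeta pq & pair_sqr pq.
Proof.
move=> kN iz; have Fksub := Fk_sub_measurable hFN (ltnW kN).
have [p zp] : exists p, is_cond_exp_mx W P k zeta p.
  apply: cond_exp_mx_exists => // i j; rewrite ord1.
  exact: square_integrable_integrable.
have [q zq] : exists q,
    is_cond_exp_mx W P k (fun w => zeta w *m (W k.+1 w)^T) q.
  apply: cond_exp_mx_exists => // i l; rewrite mul_noiseE.
  apply: square_integrableM => //.
  exact: (Lc2_square_integrable hFN PP kN (W_Lc (k := k.+1) kN l)).
exists (p, q); first by split.
split => [i|i l] /=.
  exact: (cond_exp_keeps_square_integrable hFN (ltnW kN) (iz i) (zp i 0)).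
have := zq i l; rewrite mul_noiseE.
exact: (cond_exp_noise_square_integrable hTheta hFN W_Lc A3 PP kN (iz i)).
Qed.

Let adjoint_exists : exists pq : nat -> adjoint_pair,
  [/\ adjoint_step N.-1 (fun w => (varphi_x pb (X N w) w)^T) (pq N.-1),
      forall k, (k <= N.-1)%N -> pair_sqr (pq k) &
      forall k, (k < N.-1)%N -> adjoint_step k (rhs k.+1 (pq k.+1)) (pq k)].
Proof.
have NN : (N.-1 < N)%N by rewrite prednK.
apply: (@backward_recursion _ _ (fun _ => pair_sqr)
  (fun k pq' pq => adjoint_step k (rhs k.+1 pq') pq)).
  apply: adjoint_step_exists => // i; under eq_fun do rewrite mxE.
  exact: terminal_gradient_square_integrable.
move=> k pq kN ipq; have kN1 : (k.+1 < N)%N by rewrite -ltn_predRL.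
apply: adjoint_step_exists; first exact: ltnW.
by move=> i; exact: rhs_sqr.
Qed.

Let adjoint_unique Pk Qk Pk' Qk' :
    adjoint_solution N W pb ustar P Pk Qk ->
    adjoint_solution N W pb ustar P Pk' Qk' ->
  forall j, (j < N)%N ->
    {ae P, forall w, Pk' (N.-1 - j)%N w = Pk (N.-1 - j)%N w /\
                     Qk' (N.-1 - j)%N w = Qk (N.-1 - j)%N w}.
Proof.
move=> [tP tQ rec] [tP' tQ' rec'].
have uniq k (Z Z' : Omega -> 'cV[R]_n) (V : Omega -> 'cV[R]_d)
    p p' q q' : (k <= N)%N ->
    {ae P, forall w, Z' w = Z w} ->
    is_cond_exp_mx W P k Z p -> is_cond_exp_mx W P k Z' p' ->
    is_cond_exp_mx W P k (fun w => Z w *m (V w)^T) q ->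
    is_cond_exp_mx W P k (fun w => Z' w *m (V w)^T) q' ->
    {ae P, forall w, p' w = p w /\ q' w = q w}.
  move=> kN ZZ Zp Zp' Zq Zq'; have Fksub := Fk_sub_measurable hFN kN.
  have pp := cond_exp_mx_unique Fksub ZZ Zp' Zp.
  have ZZV : {ae P, forall w, Z' w *m (V w)^T = Z w *m (V w)^T}.
    by apply: filterS ZZ => w ->.
  have qq := cond_exp_mx_unique Fksub ZZV Zq' Zq.
  by apply: filterS2 pp qq.
elim=> [_|j IH jN].
  rewrite subn0; apply: (uniq _ _ _ _ _ _ _ _ _ _ tP tP' tQ tQ').
    exact: leq_pred.
  by apply: aeW.
have jN1 : (j < N.-1)%N by rewrite ltn_predRL.
pose k := (N.-1 - j.+1)%N.
have kE : (N.-1 - j = k.+1)%N by rewrite /k subnSK.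
have k1N : (k.+1 < N)%N.
  by rewrite -kE (leq_ltn_trans (leq_subr _ _))// ltn_predL.
have [rP rQ] := rec k k1N; have [rP' rQ'] := rec' k k1N.
apply: (uniq _ _ _ _ _ _ _ _ _ _ rP rP' rQ rQ').
  by rewrite ltnW// ltnW.
have := IH (ltnW jN); rewrite kE; apply: filterS => w [eP eQ].
by rewrite /adjoint_rhs eP eQ.
Qed.

Lemma adjoint_equation_well_posed : exists Pk Qk,
  [/\ adjoint_solution N W pb ustar P Pk Qk,
      adjoint_bound N W P Pk Qk &
      forall Pk' Qk',
        adjoint_solution N W pb ustar P Pk' Qk' ->
        adjoint_bound N W P Pk' Qk' ->
        forall k, (k < N)%N ->
          {ae P, forall w, Pk' k w = Pk k w /\ Qk' k w = Qk k w}].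
Proof.
have [pq [term sqr rec]] := adjoint_exists.
have sol : adjoint_solution N W pb ustar P
    (fun k => (pq k).1) (fun k => (pq k).2).
  split; [exact: term.1| |].
    by have := term.2; rewrite prednK.
  by move=> k kN; apply: rec; rewrite ltn_predRL.
exists (fun k => (pq k).1), (fun k => (pq k).2); split => //.
  move=> k xi kN [mxi xioo]; rewrite unlock.
  have Fksub := Fk_sub_measurable hFN (ltnW kN).
  have ixi : square_integrable P xi.
    move: xioo; rewrite unlock => xioo.
    apply: (square_integrable_bound _ _ xioo).
      exact: Fk_measurable_measurable Fksub mxi.
    rewrite le_eqVlt; apply/orP; left; apply/eqP; apply: eq_integral => w _.
    by rewrite real_normK// num_real.
  have kN1 : (k <= N.-1)%N by rewrite -ltnS (prednK hN).
  have [ip iq] := sqr k kN1.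
  have iP : square_integrable P (fun w => enorm ((pq k).1 w)).
    by apply: square_integrable_enorm => i j; rewrite ord1.
  have iQ : square_integrable P (fun w => enorm ((pq k).2 w)).
    exact: square_integrable_enorm.
  have iN := square_integrable_norm ixi.
  have := integrable_fin_num measurableT
    (integrableD_EFin (square_integrableM iP iN) (square_integrableM iQ iN)).
  by rewrite ltey_eq => ->.
move=> Pk' Qk' sol' _ k kN.
have kN1 : (k <= N.-1)%N by rewrite -ltnS (prednK hN).
have := adjoint_unique sol sol' (j := N.-1 - k); rewrite subKn//; apply.
by rewrite -[ltnRHS](prednK hN) ltnS leq_subr.
Qed.

End adjoint.

Theorem lemma4p5 (R : realType) (d n m N : nat) (hd : (0 < d)%N)
    (hN : (0 < N)%N)
    (disp : measure_display) (Omega : measurableType disp)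
    (Theta : Type) (hTheta : inhabited Theta)
    (F : Theta -> probability (borelM R d 1) R)
    (W : nat -> Omega -> 'cV[R]_d)
    (hFN : @measurable _ Omega = Fk W N)
    (hW : standing_assumptions N F W)
    (pb : problem R Omega d n m)
    (hU : convex_controls N pb)
    (hdiff : differentiable_coefficients N pb)
    (H1 : assumption_H1 N F W pb)
    (H2 : assumption_H2 N pb)
    (H3 : assumption_H3 N pb)
    (ustar : nat -> Omega -> 'cV[R]_m)
    (hopt : optimal N F W pb ustar)
    (Pstar : probability Omega R)
    (hPstar : Pstar_set N F W pb ustar Pstar)
    (hvar : (0 <= ereal_inf [set 'E_Pstar[first_variation N W pb ustar u]
                            | u in admissible N F W pb])%E) :
  exists (Pk : nat -> Omega -> 'cV[R]_n) (Qk : nat -> Omega -> 'M[R]_(n, d)),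
    [/\ adjoint_solution N W pb ustar Pstar Pk Qk,
        adjoint_bound N W Pstar Pk Qk &
        forall (Pk' : nat -> Omega -> 'cV[R]_n)
               (Qk' : nat -> Omega -> 'M[R]_(n, d)),
          adjoint_solution N W pb ustar Pstar Pk' Qk' ->
          adjoint_bound N W Pstar Pk' Qk' ->
          forall k, (k < N)%N ->
            {ae Pstar, forall w, Pk' k w = Pk k w /\ Qk' k w = Qk k w}].
Proof.
have [_ _ A3 W_Lc] := hW.
exact: (adjoint_equation_well_posed hd hN hTheta hFN W_Lc A3 hU hdiff H1 H2
  hopt.1 hPstar.1).
Qed.
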